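(* Let $G$ be a finitely generated group which is not torsion and whose cost satisfies $\mathcal{C}(G)>1$. Then the Tarski half number of $G$ equals $2$.
   Context: A paradoxical decomposition of $G$ consists of positive integers $m,n$, pairwise disjoint subsets $P_1,\ldots,P_m,Q_1,\ldots,Q_n$ of $G$ and elements $g_1,\ldots,g_m,h_1,\ldots,h_n$ with $G=\bigcup_iP_ig_i=\bigcup_jQ_jh_j$. Its half number is $\min(m,n)$, and the Tarski half number of $G$ is the minimal half number over all paradoxical decompositions of $G$ (always at least $2$). Cost: for a countable group $G$ acting almost surely freely by measure-preserving Borel maps on a standard Borel probability space $(X,\mu)$, a graphing is a countable family of Borel bijections $\phi_i\colon A_i\to B_i$ between Borel subsets with $\phi_i(x)\in G\cdot x$, such that the connected components of the graph with edges $\{x,\phi_i(x)\}$ are almost surely the $G$-orbits; its cost is $\sum_i\mu(A_i)$. The cost of the action is the infimum over graphings, and $\mathcal{C}(G)$ is the infimum over all such actions. *)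

(* Defs.v *)
From HB Require Import structures.
From mathcomp Require Import all_boot all_order all_algebra.
From mathcomp Require Import all_classical all_reals all_analysis.
From mathcomp Require Import Rstruct.
From Stdlib Require Import Relations List Rdefinitions.
Set Implicit Arguments. Unset Strict Implicit. Unset Printing Implicit Defensive.
Import Order.TTheory GRing.Theory Num.Theory.
Local Open Scope classical_set_scope.
Local Open Scope ring_scope.

Record group := Group {
  gcar :> Type;
  gmul : gcar -> gcar -> gcar;
  gone : gcar;
  ginv : gcar -> gcar;
  gmulA : forall x y z, gmul x (gmul y z) = gmul (gmul x y) z;
  gmul1l : forall x, gmul gone x = x;
  gmul1r : forall x, gmul x gone = x;
  gmulVl : forall x, gmul (ginv x) x = gone;
  gmulVr : forall x, gmul x (ginv x) = gone }.

Fixpoint gpow (G : group) (g : G) (n : nat) : G :=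
  match n with O => gone G | S k => gmul g (gpow g k) end.

Definition finitely_generated (G : group) : Prop :=
  exists S : list G, forall x : G, exists w : list (bool * G),
    Forall (fun p => In p.2 S) w /\
    x = List.fold_right (fun p acc => gmul (if p.1 then ginv p.2 else p.2) acc)
          (gone G) w.

Definition torsion (G : group) : Prop :=
  forall g : G, exists n : nat, (0 < n)%nat /\ gpow g n = gone G.

Definition rtrans (G : group) (P : set G) (g : G) : set G := (fun p => gmul p g) @` P.

Definition has_paradox_half (G : group) (k : nat) : Prop :=
  exists (m n : nat) (P : 'I_m -> set G) (Q : 'I_n -> set G)
         (g : 'I_m -> G) (h : 'I_n -> G),
    (0 < m)%nat /\ (0 < n)%nat /\
    (let F := fun i : 'I_m + 'I_n =>
                match i with inl i => P i | inr j => Q j end in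
     forall i j, i <> j -> F i `&` F j = set0) /\
    [set: G] = \bigcup_(i in [set: 'I_m]) rtrans (P i) (g i) /\
    [set: G] = \bigcup_(j in [set: 'I_n]) rtrans (Q j) (h j) /\
    k = minn m n.

Definition tarski_half_number_is (G : group) (k : nat) : Prop :=
  has_paradox_half G k /\ (forall k', has_paradox_half G k' -> (k <= k')%nat).

Definition standard_borel (d : measure_display) (X : measurableType d) : Prop :=
  exists dist : X -> X -> R,
    (forall x y, 0 <= dist x y) /\
    (forall x y, dist x y = 0 <-> x = y) /\
    (forall x y, dist x y = dist y x) /\
    (forall x y z, dist x z <= dist x y + dist y z) /\
    (forall u : nat -> X,
        (forall e : R, 0 < e -> exists N, forall p q, (N <= p)%nat -> (N <= q)%nat ->
            dist (u p) (u q) < e) ->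
        exists l, forall e : R, 0 < e -> exists N, forall p, (N <= p)%nat ->
            dist (u p) l < e) /\
    (exists s : nat -> X, forall x (e : R), 0 < e -> exists k, dist x (s k) < e) /\
    (@measurable _ X = <<s [set U : set X | forall x, U x ->
        exists e : R, 0 < e /\ (forall y, dist x y < e -> U y)] >>).

Section Cost.
Context (G : group) (d : measure_display) (X : measurableType d)
        (mu : probability X R) (a : G -> X -> X).

Definition pmp_action : Prop :=
  (forall x, a (gone G) x = x) /\
  (forall g h x, a (gmul g h) x = a g (a h x)) /\
  (forall g, measurable_fun [set: X] (a g)) /\
  (forall g A, measurable A -> mu (a g @^-1` A) = mu A).

Definition as_free : Prop :=
  mu.-negligible [set x | exists g : G, g <> gone G /\ a g x = x].

Definition graphing_edge (A : nat -> set X) (phi : nat -> X -> X) : relation X :=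
  fun x y => exists i, A i x /\ phi i x = y.

(* (A_i, phi_i) is a graphing of the action: phi_i : A_i -> B_i := phi_i(A_i)
   is a Borel bijection between Borel sets with phi_i x in the orbit of x, and
   almost surely the connected components are the orbits. *)
Definition graphing (A : nat -> set X) (phi : nat -> X -> X) : Prop :=
  (forall i, measurable (A i)) /\
  (forall i, measurable (phi i @` A i)) /\
  (forall i, measurable_fun (A i) (phi i)) /\
  (forall i x y, A i x -> A i y -> phi i x = phi i y -> x = y) /\
  (* the inverse B_i -> A_i is Borel too *)
  (forall i S, measurable S -> S `<=` A i -> measurable (phi i @` S)) /\
  (forall i x, A i x -> exists g : G, phi i x = a g x) /\
  mu.-negligible [set x | ~ (forall g : G,
       clos_refl_sym_trans X (graphing_edge A phi) x (a g x))].

Definition graphing_cost (A : nat -> set X) : \bar R :=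
  (\sum_(i <oo) mu (A i))%E.

Definition action_cost : \bar R :=
  ereal_inf [set c | exists A phi, graphing A phi /\ c = graphing_cost A].
End Cost.

Definition group_cost (G : group) : \bar R :=
  ereal_inf [set c | exists (d : measure_display) (X : measurableType d)
      (mu : probability X R) (a : G -> X -> X),
      standard_borel X /\ pmp_action mu a /\ as_free mu a /\
      c = action_cost mu a].

(* Main.v *)
(* Let z have infinite order and call the cosets <z>g lines.  A nearly cheapest
   graphing of a free action made of all edges x -> z x and of some edges
   x -> s x for generators s has volume 1 + m with m > 0.  If, in a copy of a
   finite set B, it had more generator edges starting in B than there are lines
   meeting KB (K the generators and 1), then one of these edges would be
   redundant, and removing it simultaneously over a separated set of positive
   measure would contradict near-optimality; so KB meets at least m|B| lines.
   Pushing the end points of the lines outwards turns this into exponential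
   growth, hence K'B meets at least |B| lines for a suitable finite K'.  Hall's
   theorem then provides an injection x -> f x in K'x whose image meets every
   line at most once; shifting by z the part of each line at or after its marked
   point gives a second injection, which uses only the translations 1 and z and
   avoids the image of f.  The cost hypothesis would be vacuous without a free
   action, and the Bernoulli shift on {0,1}^G provides one. *)
Require Import Defs.
From HB Require Import structures.
From mathcomp Require Import all_boot all_order all_algebra.
From mathcomp Require Import finmap.
From mathcomp Require Import all_classical all_reals all_analysis.
From mathcomp Require Import Rstruct.
From mathcomp Require Import measurable_realfun.
From mathcomp Require Import zify ring lra.
From Stdlib Require Import Relation_Operators.
Local Open Scope ring_scope.
Local Open Scope ereal_scope.

(** * Hall's theorem and redundant edges *)

Section Hall.
Local Close Scope ereal_scope.
Local Close Scope ring_scope.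
Local Open Scope nat_scope.
Local Open Scope fset_scope.
Variables T V : choiceType.
Implicit Type N : T -> {fset V}.

Definition neighbours N (B : {fset T}) : {fset V} := \bigcup_(x <- B) N x.

Definition hall_condition N := forall B : {fset T}, #|` B| <= #|` neighbours N B|.

Definition override N x F : T -> {fset V} := fun z => if z == x then F else N z.

Lemma neighboursP N (B : {fset T}) v :
  reflect (exists2 x, x \in B & v \in N x) (v \in neighbours N B).
Proof.
apply: (iffP (bigfcupP _ _ _ _)) => [[x /andP[xB _] vx]|[x xB vx]]; exists x => //.
by rewrite xB.
Qed.

(** Uncrossing: sets [A] and [B] violating the two conditions both contain [x]. Hall's condition for
    their union and for their intersection without [x], combined with inclusion-exclusion for [P]
    and [Q], contradicts the two deficiencies. *)
Lemma hall_override N x (u v : V) :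
  hall_condition N -> u != v ->
  hall_condition (override N x (N x `\ u)) \/ hall_condition (override N x (N x `\ v)).
Proof.
move=> hN uv; apply: contrapT => /not_orP[/existsNP[A nA] /existsNP[B nB]].
set P := neighbours _ A in nA; set Q := neighbours _ B in nB.
have inA F (C : {fset T}) : (#|` C| <= #|` neighbours (override N x F) C|) <> true -> x \in C.
  move=> nC; apply/negPn/negP => xC; apply: nC.
  have -> : neighbours (override N x F) C = neighbours N C; last exact: hN.
  apply/fsetP => w; apply/neighboursP/neighboursP => -[z zC]; rewrite /override.
    by case: eqP zC => [->|]; [rewrite (negPf xC)|exists z].
  by move=> wz; exists z => //; case: eqP zC => [->|//]; rewrite (negPf xC).
have xA := inA _ _ nA; have xB := inA _ _ nB.
(* Only [x] loses an element, [u] in [P] and [v] in [Q]; as [u != v], the union misses nothing. *)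
have PQ1 : neighbours N (A `|` B) `<=` P `|` Q.
  apply/fsubsetP => w /neighboursP[z]; rewrite in_fsetU => zAB wz.
  rewrite in_fsetU; have [zx|zx] := eqVneq z x.
    have [wu|wu] := eqVneq w u.
      apply/orP; right; apply/neighboursP; exists x => //.
      by rewrite /override eqxx !inE wu uv -wu -zx.
    apply/orP; left; apply/neighboursP; exists x => //.
    by rewrite /override eqxx !inE wu -zx.
  by case/orP: zAB => zi; apply/orP; [left|right]; apply/neighboursP;
    exists z => //; rewrite /override (negPf zx).
have PQ2 : neighbours N ((A `&` B) `\ x) `<=` P `&` Q.
  apply/fsubsetP => w /neighboursP[z]; rewrite !inE => /and3P[zx zA zB] wz.
  by apply/andP; split; apply/neighboursP; exists z => //; rewrite /override (negPf zx).
have c1 := leq_trans (hN _) (fsubset_leq_card PQ1).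
have c2 := leq_trans (hN _) (fsubset_leq_card PQ2).
have c3 := cardfsUI A B; have c4 := cardfsUI P Q.
have c5 := cardfsD1 x (A `&` B).
have xAB : x \in A `&` B by rewrite inE xA xB.
rewrite xAB in c5.
move: nA nB => /negP + /negP; rewrite -!ltnNge => nA nB.
lia.
Qed.

Lemma hall_nonempty N x : hall_condition N -> N x != fset0.
Proof.
move=> /(_ [fset x]); rewrite cardfs1 -cardfs_gt0 => /leq_trans; apply.
apply: fsubset_leq_card; apply/fsubsetP => w /neighboursP[z].
by rewrite inE => /eqP ->.
Qed.

Lemma override_id N x : override N x (N x) = N.
Proof. by apply/funext => z; rewrite /override; case: eqP => // ->. Qed.

Lemma override_override N x F F' : override (override N x F) x F' = override N x F'.
Proof. by apply/funext => z; rewrite /override; case: eqP. Qed.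

(** Induction on the size of the neighbourhood of [x]: out of any two of its elements, one can be
    discarded. *)
Lemma hall_shrink N x : hall_condition N ->
  exists y, y \in N x /\ hall_condition (override N x [fset y]).
Proof.
move: {2}(#|` N x|) (leqnn #|` N x|) => n; elim: n N => [|n IHn] N cN hN.
  by move: cN; rewrite leqn0 cardfs_eq0 (negPf (hall_nonempty _ _ hN)).
have /fset0Pn[y yN] := hall_nonempty _ x hN.
have [NE|] := eqVneq (N x `\ y) fset0.
  exists y; split => //.
  suff -> : [fset y] = N x by rewrite override_id.
  by rewrite -(fsetD1K yN) NE fsetU0.
case/fset0Pn => v; rewrite !inE => /andP[vy vN].
suff H w : w \in N x -> hall_condition (override N x (N x `\ w)) ->
    exists y, y \in N x /\ hall_condition (override N x [fset y]).
  by have [] := hall_override N x y v hN; [rewrite eq_sym|exact: H|exact: H].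
move=> wN hw; have := cardfsD1 w (N x); rewrite wN => cw.
have [] := IHn _ _ hw; first by rewrite /override eqxx; lia.
move=> z; rewrite override_override {1}/override eqxx !inE => -[/andP[_ zN] hz].
by exists z.
Qed.

(* Rado's argument: neighbourhoods are shrunk to singletons one vertex at a
   time, keeping Hall's condition; no compactness is needed. *)
Theorem hall_injection N (e : nat -> T) : (forall x, exists n, e n = x) ->
  hall_condition N -> exists f : T -> V, injective f /\ forall x, f x \in N x.
Proof.
move=> esurj hN.
have step (M : {M | hall_condition M}) (x : T) :
    {M' : {M' | hall_condition M'} | exists2 y, y \in sval M x &
      sval M' = override (sval M) x [fset y]}.
  apply: cid; case: M => M hM /=; have [y [yM hy]] := hall_shrink _ x hM.
  by exists (exist _ _ hy); exists y.
pose F := fix F k := if k is k'.+1 then sval (step (F k') (e k')) else exist _ N hN.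
have Fsub k z : sval (F k.+1) z `<=` sval (F k) z.
  have [y yz FE] := svalP (step (F k) (e k)).
  rewrite [F k.+1]/= FE /override; case: eqP => [->|_]; last exact: fsubset_refl.
  by rewrite fsub1set.
have Fmono j k z : j <= k -> sval (F k) z `<=` sval (F j) z.
  move=> /subnK <-; elim: (k - j) => [|i IH]; first exact: fsubset_refl.
  by apply: fsubset_trans IH; rewrite addSn.
have Fsing x : {y | exists k, forall j, k <= j -> sval (F j) x = [fset y]}.
  apply: cid; have [k ek] := esurj x.
  have [y yz FE] := svalP (step (F k) (e k)).
  exists y, k.+1 => j kj; have := Fmono _ _ x kj.
  rewrite [F k.+1]/= FE /override ek eqxx fsubset1 => /orP[/eqP //|].
  by rewrite (negPf (hall_nonempty _ _ (svalP (F j)))).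
exists (fun x => sval (Fsing x)); split => [x x' xx'|x]; last first.
  have [k Hk] := svalP (Fsing x); have := Fmono 0 k x isT.
  by rewrite Hk // fsub1set.
have [k Hk] := svalP (Fsing x); have [k' Hk'] := svalP (Fsing x').
apply/eqP/negPn/negP => nxx.
(* At this stage both neighbourhoods are the same singleton, so two vertices would share a single
   neighbour. *)
have := svalP (F (maxn k k')) [fset x; x'].
suff /fsubset_leq_card : neighbours (sval (F (maxn k k'))) [fset x; x'] `<=`
    [fset sval (Fsing x)].
  by rewrite cardfs1 cardfs2 nxx => /[swap] /leq_trans /[apply].
apply/fsubsetP => w /neighboursP[z]; rewrite !inE => /orP[]/eqP ->.
  by rewrite Hk ?leq_maxl // inE.
by rewrite Hk' ?leq_maxr // inE xx'.
Qed.
End Hall.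

(** * Cycles in finite multigraphs *)

Section Cycle.
Local Close Scope ereal_scope.
Import GRing.Theory.

Definition edge_rel {T V : finType} (u v : T -> V) (L : {set T}) : rel V :=
  fun x y => [exists t in L, ((u t == x) && (v t == y)) || ((u t == y) && (v t == x))].

(* A linear dependency between the vectors [e_u - e_v] of the edges is tested
   against the indicator of the component of one edge of its support. *)
Lemma redundant_edge (T V : finType) (u v : T -> V) (L : {set T}) : (#|V| < #|L|)%N ->
  exists2 t, t \in L & connect (edge_rel u v (L :\ t)) (u t) (v t).
Proof.
move=> VL.
(* The rows are signed incidence vectors; there are more rows than columns, so the left kernel is
   nonzero. *)
pose M : 'M[rat]_(#|L|, #|V|) := \matrix_(i, j)
  ((u (enum_val i) == enum_val j)%:R - (v (enum_val i) == enum_val j)%:R).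
have : kermx M != 0.
  by rewrite -mxrank_eq0 mxrank_ker subn_eq0 -ltnNge (leq_ltn_trans (rank_leq_col _)).
case/matrix0Pn => k [i0 ki0].
have wM : row k (kermx M) *m M = 0 by rewrite -row_mul mulmx_ker row0.
set t0 := enum_val i0; exists t0; first exact: enum_valP.
set r := edge_rel _ _ _.
have rsym : connect_sym r.
  apply: sym_connect_sym => x y; rewrite /r /edge_rel.
  by apply/existsP/existsP => -[t Ht]; exists t; rewrite orbC.
(* Indicator of the component of [u t0] once [t0] is deleted. Every other edge of [L] has both ends
   in it or both outside, so pairing the dependency with [f] leaves only the term of [t0], whose
   coefficient is nonzero. *)
pose f : 'cV[rat]_#|V| := \col_j (connect r (u t0) (enum_val j))%:R.
have Mf i : (M *m f) i 0 = (connect r (u t0) (u (enum_val i)))%:R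
                           - (connect r (u t0) (v (enum_val i)))%:R.
  have pick (y : V) : \sum_j (y == enum_val j :> V)%:R * f j 0 = (connect r (u t0) y)%:R.
    rewrite (bigD1 (enum_rank y)) //= big1 => [|j jy].
      by rewrite mxE enum_rankK eqxx mul1r addr0.
    rewrite (_ : (_ == _) = false) ?mul0r //; apply: contraNF jy => /eqP ->.
    by rewrite enum_valK.
  rewrite mxE -!pick -sumrB; apply: eq_bigr => j _; by rewrite mxE mulrBl.
have := congr1 (fun A => (A *m f) 0 0) wM.
rewrite -mulmxA mul0mx [RHS]mxE mxE (bigD1 i0) //= big1 => [|i ii0].
  rewrite addr0 Mf connect0 mxE => /eqP; rewrite mulf_eq0 (negPf ki0) /= subr_eq0.
  by case: connect.
rewrite Mf (_ : connect r _ _ = connect r (u t0) (v (enum_val i))) ?subrr ?mulr0 //.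
apply: same_connect_r => //; apply: connect1; apply/existsP; exists (enum_val i).
rewrite !inE enum_valP andbT !eqxx /= andbT.
by apply: contraNneq ii0 => /enum_val_inj ->.
Qed.
End Cycle.

(** * The Bernoulli shift *)

Section CoinMetric.
Import Order.TTheory GRing.Theory Num.Theory.
Local Close Scope ereal_scope.
Local Open Scope classical_set_scope.
Local Notation R := Rdefinitions.R.
Implicit Types (x y z : nat -> bool) (s : seq bool).

Lemma half_lt {K : realType} n m : ((2^-1 : K) ^+ n < 2^-1 ^+ m) = (m < n)%N.
Proof. by rewrite ltr_iXn2l // ?invr_gt0 // invf_lt1 // ltr1n. Qed.

Lemma half_le {K : realType} n m : ((2^-1 : K) ^+ n <= 2^-1 ^+ m) = (m <= n)%N.
Proof. by rewrite ler_iXn2l // ?invr_gt0 // invf_lt1 // ltr1n. Qed.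

Lemma half_gt0 {K : realType} n : 0 < (2^-1 : K) ^+ n.
Proof. by rewrite exprn_gt0 // invr_gt0. Qed.

Lemma half_lt_eps {K : realType} (e : K) : 0 < e -> exists n, (2^-1 : K) ^+ n < e.
Proof.
move=> e0; have := archi_boundP (ltW (divr_gt0 ltr01 e0)).
set n := Num.Def.archi_bound _ => en; exists n.
rewrite exprVn invf_plt ?posrE ?exprn_gt0 // -div1r (lt_trans en) //.
by rewrite -natrX ltr_nat ltn_expl.
Qed.

(** The usual ultrametric of Cantor space, whose open balls are the cylinders. *)
Definition coin_dist x y : R :=
  if pselect (exists n, x n != y n) is left h then 2^-1 ^+ ex_minn h else 0.

Lemma coin_dist_le n x y :
  coin_dist x y <= 2^-1 ^+ n <-> forall i, (i < n)%N -> x i = y i.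
Proof.
rewrite /coin_dist; case: pselect => [h|nh]; last first.
  split=> _; last exact/ltW/half_gt0.
  by move=> i _; apply/eqP/negPn/negP => xy; apply: nh; exists i.
case: ex_minnP => k xyk kmin; rewrite half_le; split=> [nk i ik|xy].
  by apply/eqP/negPn/negP => /kmin; rewrite leqNgt (leq_trans ik).
by rewrite leqNgt; apply/negP => /xy /eqP; rewrite (negPf xyk).
Qed.

Lemma coin_dist_lt n x y : coin_dist x y < 2^-1 ^+ n -> forall i, (i <= n)%N -> x i = y i.
Proof.
rewrite /coin_dist; case: pselect => [h|nh _ i _]; last first.
  by apply/eqP/negPn/negP => xy; apply: nh; exists i.
case: ex_minnP => k xyk kmin; rewrite half_lt => nk i ik.
by apply/eqP/negPn/negP => /kmin; rewrite leqNgt (leq_ltn_trans ik).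
Qed.

Lemma coin_dist_val x y : (x = y /\ coin_dist x y = 0) \/ exists n, coin_dist x y = 2^-1 ^+ n.
Proof.
rewrite /coin_dist; case: pselect => [h|nh]; first by right; exists (ex_minn h).
left; split => //; apply/funext => i.
by apply/eqP/negPn/negP => xy; apply: nh; exists i.
Qed.

Lemma coin_dist_ge0 x y : 0 <= coin_dist x y.
Proof.
have [[_ ->]|[n ->]] := coin_dist_val x y; [exact: lexx|exact/ltW/half_gt0].
Qed.

Lemma coin_dist_eq0 x y : coin_dist x y = 0 <-> x = y.
Proof.
split=> [xy0|->]; last by rewrite /coin_dist; case: pselect => // h; have [n] := h; rewrite eqxx.
by have [[]//|[n xyn]] := coin_dist_val x y; have := half_gt0 (K := R) n; rewrite -xyn xy0 ltxx.
Qed.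

Lemma coin_dist_sym x y : coin_dist x y = coin_dist y x.
Proof.
have le u v : coin_dist u v <= coin_dist v u.
  have [[-> ->]|[n vun]] := coin_dist_val v u.
    exact: lexx.
  rewrite vun; apply/coin_dist_le => i ni; apply: esym; move: i ni.
  by apply/coin_dist_le; rewrite vun.
by apply/eqP; rewrite eq_le !le.
Qed.

Lemma coin_dist_triangle x y z : coin_dist x z <= coin_dist x y + coin_dist y z.
Proof.
have [[-> ->]|[n xyn]] := coin_dist_val x y; first by rewrite add0r.
have [[-> ->]|[m yzm]] := coin_dist_val y z; first by rewrite addr0.
have := half_gt0 (K := R) n; have := half_gt0 (K := R) m.
have hxy : coin_dist x y <= 2^-1 ^+ n by rewrite xyn.
have hyz : coin_dist y z <= 2^-1 ^+ m by rewrite yzm.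
rewrite xyn yzm => m0 n0; have [nm|mn] := leqP n m.
  suff : coin_dist x z <= 2^-1 ^+ n by lra.
  apply/coin_dist_le => i ni.
  by rewrite (iffLR (coin_dist_le n x y)) ?(iffLR (coin_dist_le m y z)) // (leq_trans ni).
suff : coin_dist x z <= 2^-1 ^+ m by lra.
apply/coin_dist_le => i ni.
by rewrite (iffLR (coin_dist_le n x y)) ?(iffLR (coin_dist_le m y z)) // (ltn_trans ni).
Qed.

(** Written exactly like the open sets in [standard_borel], so that the requirement there on the
    sigma-algebra holds by definition. *)
Definition coin_open : set (set (nat -> bool)) :=
  [set U : set (nat -> bool) | forall x, U x ->
        exists e : R, 0 < e /\ (forall y, coin_dist x y < e -> U y)].

Notation coin_space := (g_sigma_algebraType coin_open).

Lemma standard_borel_coin : @standard_borel _ coin_space.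
Proof.
exists coin_dist; split; first exact: coin_dist_ge0.
split; first exact: coin_dist_eq0.
split; first exact: coin_dist_sym.
split; first exact: coin_dist_triangle.
split; last split => //.
  move=> u cu; have {}cu n : {N | forall p q, (N <= p)%N -> (N <= q)%N ->
      coin_dist (u p) (u q) < 2^-1 ^+ n}.
    exact/cid/cu/half_gt0.
  (* Coordinate [i] of a Cauchy sequence is constant from the stage [cu i] on. *)
  pose l i := u (sval (cu i)) i.
  exists l => e /half_lt_eps[n ne].
  exists (\max_(i < n.+1) sval (cu i)) => p pn; apply: le_lt_trans ne.
  apply/coin_dist_le => i ni.
  apply: (@coin_dist_lt i (u p) (u (sval (cu i)))) => //; apply: (svalP (cu i)) => //.
  by apply: leq_trans pn; apply: (leq_bigmax (Ordinal (ltnW ni : i < n.+1)%N)).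
(* The dense sequence lists the finite words, continued by [false]; codes of no word give the empty
   word. *)
exists (fun k : nat => nth false (odflt [::] (choice.unpickle k : option (seq bool))))
  => x e /half_lt_eps[n ne].
exists (choice.pickle (mkseq x n)); apply: le_lt_trans ne; apply/coin_dist_le => i ni.
by rewrite choice.pickleK /= nth_mkseq.
Qed.

Definition cylinder s : set (nat -> bool) := [set x | mkseq x (size s) = s].

Lemma cylinderE s : cylinder s = [set x | forall i, (i < size s)%N -> x i = nth false s i].
Proof.
apply/seteqP; split => x /=; rewrite /cylinder /=.
  by move=> <- i; rewrite size_mkseq => ?; rewrite nth_mkseq.
move=> xs; apply: (@eq_from_nth _ false); rewrite size_mkseq // => i si.
by rewrite nth_mkseq // xs.
Qed.

(** The empty set is included to make this family closed under intersection. *)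
Definition cylinders : set (set (nat -> bool)) :=
  [set A | A = set0 \/ exists s, A = cylinder s].

Lemma cylinder_open s : coin_open (cylinder s).
Proof.
rewrite cylinderE => x /= xs; exists (2^-1 ^+ size s); split; first exact: half_gt0.
by move=> y xy i si; rewrite -xs // -(coin_dist_lt _ _ _ xy) // ltnW.
Qed.

(** There are only countably many cylinders, so an open set is the countable union of those it
    contains. *)
Lemma coin_measurableE : @measurable _ coin_space = <<s cylinders >>.
Proof.
apply/seteqP; split; last first.
  apply: smallest_sub; first exact: smallest_sigma_algebra.
  move=> A [->|[s ->]]; first exact: sigma_algebra0.
  by apply: sub_sigma_algebra; apply: cylinder_open.
apply: smallest_sub; first exact: smallest_sigma_algebra.
move=> U oU; rewrite (_ : U = \bigcup_k
    (if `[< cylinder (odflt [::] (choice.unpickle k)) `<=` U >]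
     then cylinder (odflt [::] (choice.unpickle k)) else set0)).
  apply: sigma_algebra_bigcup => k; apply: sub_sigma_algebra.
  by case: ifP => _; [right; eexists|left].
apply/seteqP; split => [x /oU[e [/half_lt_eps[n ne] eU]]|x [k _]]; last first.
  by case: asboolP => // /[apply].
exists (choice.pickle (mkseq x n)) => //; rewrite choice.pickleK /=; case: asboolP => [_|].
  by rewrite /cylinder /= size_mkseq.
case=> y /=; rewrite /cylinder /= size_mkseq => yx; apply: eU; apply: le_lt_trans ne.
apply/coin_dist_le => i ni.
by have := congr1 (nth false ^~ i) yx; rewrite /= !nth_mkseq.
Qed.

Lemma cylinders_setI : setI_closed cylinders.
Proof.
move=> _ _ [->|[s ->]] [->|[t ->]]; rewrite ?set0I ?setI0; try by left.
wlog st : s t / (size s <= size t)%N.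
  by move=> H; have [/H//|/ltnW/H] := leqP (size s) (size t); rewrite setIC.
have [ts|ts] := eqVneq (take (size s) t) s; [right; exists t|left].
  apply/seteqP; split => x; rewrite /cylinder /=; [by case|move=> xt; split => //].
  by rewrite -ts -xt -map_take size_map take_iota size_iota (minn_idPl st).
apply/seteqP; split => // x; rewrite /cylinder /= => -[xs xt].
by case/eqP: ts; rewrite -xt -map_take take_iota (minn_idPl st).
Qed.

Lemma measurable_coord n b : measurable ([set x | x n = b] : set coin_space).
Proof.
apply: sub_sigma_algebra => x /= xb; exists (2^-1 ^+ n); split; first exact: half_gt0.
by move=> y /coin_dist_lt <-.
Qed.

Lemma measurable_cylinder s : measurable (cylinder s : set coin_space).
Proof. by apply: sub_sigma_algebra; apply: cylinder_open. Qed.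

Lemma measurable_fun_coin d (T : measurableType d) (f : T -> coin_space) :
  (forall n, measurable [set t | f t n]) -> measurable_fun [set: T] f.
Proof.
move=> mf; apply: (measurability _ coin_measurableE) => _ [B [->|[s ->]] <-].
  by rewrite preimage_set0 setI0.
rewrite setTI cylinderE (_ : _ @^-1` _ = \bigcap_i
    [set t | (i < size s)%N -> f t i = nth false s i]); last first.
  by apply/seteqP; split => t /= h i; [move=> _|]; apply: h.
apply: bigcapT_measurable => i; case: (ltnP i (size s)) => [_|_]; last first.
  by rewrite (_ : [set _ | _] = setT) //; apply/seteqP; split.
case: (nth false s i).
  rewrite (_ : [set _ | _] = [set t | f t i]) //.
  by apply/seteqP; split => t /=; [exact|move=> -> _].
rewrite (_ : [set _ | _] = ~` [set t | f t i]); first exact: measurableC.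
apply/seteqP; split => t /=; first by move=> /(_ isT) ->.
by move=> /negP/negbTE -> _.
Qed.
End CoinMetric.
Notation coin_space := (g_sigma_algebraType coin_open).

(** * The fair coin measure *)

Section CoinMeasure.
Import Order.TTheory GRing.Theory Num.Theory.
Local Close Scope ereal_scope.
Local Open Scope classical_set_scope.
Context {R : realType}.
Implicit Types (s : seq bool).

(** The doubling map of the unit interval; the binary digits of a point record its itinerary through
    the two halves. *)
Definition doubling (t : R) : R := if t < 2^-1 then t *+ 2 else t *+ 2 - 1.

Definition binary_digits (t : R) : nat -> bool := fun n => 2^-1 <= iter n doubling t.

Lemma measurable_doubling : measurable_fun [set: R] doubling.
Proof.
apply: measurable_fun_ifT.
- exact: measurable_fun_ltr.
- exact: measurable_funD.
- by apply: measurable_funD => //; apply: measurable_funD.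
Qed.

Lemma measurable_binary_digits :
  measurable_fun [set: R] (binary_digits : R -> coin_space).
Proof.
apply: measurable_fun_coin => n.
have mi : measurable_fun [set: R] (iter n doubling).
  elim: n => [|n IH]; first exact: measurable_id.
  exact: measurableT_comp measurable_doubling IH.
have := @measurable_fun_ler _ _ R setT (cst 2^-1) (iter n doubling) (measurable_cst _) mi.
by move=> /(_ measurableT [set true] (ltac:(by []))); rewrite setTI.
Qed.

Definition digit_map : measurableTypeR R -> coin_space := binary_digits.

HB.instance Definition _ :=
  @isMeasurableFun.Build _ _ (measurableTypeR R) coin_space digit_map
    measurable_binary_digits.

(** The law of the binary digits of a uniform point of the unit interval. *)
Definition coin_measure : probability coin_space R :=
  distribution (uniform_prob (@ltr01 R)) digit_map.

(** Left end of the dyadic interval of the points whose expansion begins with [s]. *)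
Fixpoint dyadic s : R := if s is b :: s' then (b%:R + dyadic s') / 2 else 0.


Lemma cylinder_cons b s (x : nat -> bool) :
  cylinder (b :: s) x <-> x 0%N = b /\ cylinder s (x \o succn).
Proof.
rewrite !cylinderE; split => [xs|[xb xs] [|i] //]; last exact: xs.
by split; [exact: (xs 0%N)|move=> i si; exact: (xs i.+1)].
Qed.

Lemma binary_digitsS t : binary_digits t \o succn = binary_digits (doubling t).
Proof. by apply/funext => n; rewrite /binary_digits /= -iterSr. Qed.

Lemma dyadic_itv s : 0 <= dyadic s <= 1 - 2^-1 ^+ size s.
Proof.
elim: s => [|b s /andP[IH1 IH2]] /=; first by rewrite expr0 subrr lexx.
rewrite exprS; set e := _ ^+ _ in IH2 *; case: b; rewrite ?(mulr1n, mulr0n); lra.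
Qed.

(** With [dyadic_cylinder], this squeezes a cylinder between the open and the closed dyadic interval
    of the same length, so the digits of the end points need not be decided. *)
Lemma cylinder_dyadic s t : 0 <= t <= 1 -> cylinder s (binary_digits t) ->
  dyadic s <= t <= dyadic s + 2^-1 ^+ size s.
Proof.
elim: s t => [|b s IH] t; first by rewrite /= expr0 add0r.
move=> t01 /cylinder_cons[]; rewrite binary_digitsS /binary_digits /= => tb /IH.
rewrite exprS; set e := _ ^+ _.
move: tb; rewrite /doubling; case: ltP => t2 <- /=; rewrite ?(mulr1n, mulr0n) => H.
  have /H : 0 <= t *+ 2 <= 1 by lra.
  by lra.
have /H : 0 <= t *+ 2 - 1 <= 1 by lra.
by lra.
Qed.
Lemma dyadic_cylinder s t :
  dyadic s < t < dyadic s + 2^-1 ^+ size s -> cylinder s (binary_digits t).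
Proof.
elim: s t => [|b s IH] t; first by [].
have := dyadic_itv s; rewrite /= exprS.
set e := _ ^+ _ => s01 H; apply/cylinder_cons; rewrite binary_digitsS.
rewrite /binary_digits /= /doubling.
by case: ltP => t2; case: b H => /=; rewrite ?(mulr1n, mulr0n) => H;
  try lra; split => //; apply: IH; rewrite -/e; lra.
Qed.

Lemma coin_cylinder s : coin_measure (cylinder s) = (2^-1 ^+ size s)%:E.
Proof.
rewrite /coin_measure /= /distribution /= /pushforward /= /uniform_prob.
set A := binary_digits @^-1` cylinder s.
have mA : measurable (A : set (measurableTypeR R)).
  rewrite -[A]setTI; apply: measurable_binary_digits => //; exact: measurable_cylinder.
rewrite integral_uniform_pdf (eq_integral (fun=> 1%:E)); last first.
  by move=> x; rewrite inE /= in_itv /= /uniform_pdf => -[_ ->]; rewrite subr0 invr1.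
rewrite integral_cst /= ?mul1e; last exact: measurableI.
have e0 : 0 < (2^-1 : R) ^+ size s by rewrite exprn_gt0 // invr_gt0.
apply/eqP; rewrite eq_le; apply/andP; split.
  have <- : lebesgue_measure `[dyadic s, dyadic s + 2^-1 ^+ size s]%classic
      = (2^-1 ^+ size s)%:E.
    by rewrite lebesgue_measure_itv /= lte_fin ltrDl e0 -EFinB addrAC subrr add0r.
  apply: le_measure; rewrite ?inE //; first exact: measurableI.
  by move=> t [At]; rewrite /= !in_itv /= => t01; exact: cylinder_dyadic.
have <- : lebesgue_measure `]dyadic s, dyadic s + 2^-1 ^+ size s[%classic
    = (2^-1 ^+ size s)%:E.
  by rewrite lebesgue_measure_itv /= lte_fin ltrDl e0 -EFinB addrAC subrr add0r.
apply: le_measure; rewrite ?inE //; first exact: measurableI.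
move=> t /=; rewrite !in_itv /= => tI; split; first exact: dyadic_cylinder.
by have := dyadic_itv s; lra.
Qed.
End CoinMeasure.

(** * Flips and permutations of coordinates *)

Section CoinInvariance.
Import Order.TTheory GRing.Theory Num.Theory.
Local Close Scope ereal_scope.
Local Open Scope classical_set_scope.
Context {R : realType}.
Local Notation nu := (@coin_measure R).
Implicit Types (s : seq bool) (A H : set coin_space).

(** The law of [f] and the coin measure agree on the cylinders, which are closed under intersection
    and generate. *)
Lemma coin_measure_preserving (f : coin_space -> coin_space) :
  measurable_fun [set: coin_space] f ->
  (forall s, nu (f @^-1` cylinder s) = (2^-1 ^+ size s)%:E) ->
  forall A, measurable A -> nu (f @^-1` A) = nu A.
Proof.
move=> mf fs A mA.
pose ff : {mfun coin_space >-> coin_space} :=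
  HB.pack f (isMeasurableFun.Build _ _ _ _ f mf).
apply: (@measure_unique _ _ coin_space cylinders (fun=> setT) coin_measurableE
  cylinders_setI _ _ (distribution nu ff) nu) => //.
- by move=> _; right; exists [::]; apply/seteqP; split.
- by rewrite bigcup_const //; exists 0%N.
- move=> _ [->|[s ->]]; first by rewrite !measure0.
  by transitivity ((2^-1 ^+ size s)%:E : \bar R);
    [exact: fs|apply/esym/coin_cylinder].
- move=> _; apply: (le_lt_trans (probability_le1 (distribution nu ff) measurableT)).
  exact: ltry.
Qed.

Definition flip j (x : coin_space) : coin_space := fun n => x n (+) (n == j).

Lemma measurable_flip j : measurable_fun [set: coin_space] (flip j).
Proof.
apply: measurable_fun_coin => n; rewrite /flip; case: (n == j).
  rewrite (_ : [set _ | _] = [set x | x n = false]); first exact: measurable_coord.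
  by apply/seteqP; split => x /=; rewrite addbT; case: (x n).
rewrite (_ : [set _ | _] = [set x | x n = true]); first exact: measurable_coord.
by apply/seteqP; split => x /=; rewrite addbF; case: (x n).
Qed.

Lemma flip_preserving j A : measurable A -> nu (flip j @^-1` A) = nu A.
Proof.
apply: coin_measure_preserving; first exact: measurable_flip.
move=> s; pose s' := mkseq (fun i => nth false s i (+) (i == j)) (size s).
have -> : flip j @^-1` cylinder s = cylinder s'.
  apply/seteqP; split => x; rewrite !cylinderE /= size_mkseq => xs i si.
    by rewrite nth_mkseq // -xs // /flip addbK.
  by rewrite /flip xs // nth_mkseq // addbK.
by rewrite coin_cylinder size_mkseq.
Qed.

(** The flip of coordinate [j] preserves the measure and exchanges the parts of [A] inside and
    outside [H]. This serves as the independence of coordinate [j]. *)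
Lemma measure_halved j A H : measurable A -> measurable H ->
  (forall x, A (flip j x) <-> A x) -> (forall x, H (flip j x) <-> ~ H x) ->
  (nu (A `&` H) = (2^-1)%:E * nu A)%E.
Proof.
move=> mA mH fA fH.
have e1 : nu (A `&` ~` H) = nu (A `&` H).
  rewrite -(flip_preserving j (A `&` H)); last exact: measurableI.
  congr (nu _); apply/seteqP; split => x /= [Ax Hx].
    by split; [apply/fA|apply/fH].
  by split; [apply/fA|apply/fH].
have e2 : nu A = (nu (A `&` H) + nu (A `&` H))%E.
  rewrite -{2}e1 -measureU; first by rewrite -setIUr setUv setIT.
  - exact: measurableI.
  - by apply: measurableI => //; exact: measurableC.
  - by rewrite setIACA setICr setI0.
have fin : nu (A `&` H) \is a fin_num by apply: fin_num_measure; exact: measurableI.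
rewrite e2 -(fineK fin) -EFinD -EFinM; congr (_%:E); lra.
Qed.

Definition permute (p : nat -> nat) (x : coin_space) : coin_space := fun n => x (p n).

Lemma measurable_permute p : measurable_fun [set: coin_space] (permute p).
Proof. by apply: measurable_fun_coin => n; exact: (measurable_coord (p n) true). Qed.

(** Each letter appended to a word constrains a coordinate that, by injectivity, the earlier letters
    do not read, so it halves the measure. *)
Lemma permute_preserving p : injective p -> forall A, measurable A ->
  nu (permute p @^-1` A) = nu A.
Proof.
move=> pinj; apply: coin_measure_preserving; first exact: measurable_permute.
elim/last_ind => [|s b IH].
  rewrite (_ : _ @^-1` _ = setT); last by apply/seteqP; split.
  by rewrite probability_setT expr0.
set A : set coin_space := (_ @^-1` _) in IH.
have -> : permute p @^-1` cylinder (rcons s b) =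
    A `&` [set x | x (p (size s)) = b].
  rewrite /A !cylinderE; apply/seteqP; split => x /=; rewrite size_rcons.
    move=> xs; split=> [i si|]; first by rewrite xs ?(leqW si) // nth_rcons si.
    by have := xs _ (ltnSn _); rewrite nth_rcons ltnn eqxx.
  move=> [xs xb] i; rewrite ltnS leq_eqVlt nth_rcons => /orP[/eqP ->|si].
    by rewrite ltnn eqxx; exact: xb.
  by rewrite si xs.
rewrite (measure_halved (p (size s))).
- by rewrite IH -EFinM size_rcons exprS.
- rewrite -[A]setTI; apply: measurable_permute => //; exact: measurable_cylinder.
- exact: measurable_coord.
- move=> x; rewrite /A !cylinderE /=.
  by split => xs i si; have := xs i si; rewrite /permute /flip /=;
    case: eqP => [/pinj e|_]; rewrite ?addbF //; rewrite e ltnn in si.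
- by move=> x /=; rewrite /flip eqxx addbT; case: (x _); case: b.
Qed.

(** Finite-window approximations, decreasing to the fixed-point set of [permute p]. *)
Definition repetition (p : nat -> nat) n : set coin_space :=
  [set x | forall i, (i < n)%N -> x (p i) = x i].

Lemma measurable_coord_eq i j : measurable ([set x | x i = x j] : set coin_space).
Proof.
rewrite (_ : [set _ | _] = [set x | x i = true] `&` [set x | x j = true] `|`
    [set x | x i = false] `&` [set x | x j = false]).
  by apply: measurableU; apply: measurableI; exact: measurable_coord.
apply/seteqP; split => x /=; last by move=> [[-> ->]|[-> ->]].
by move=> ->; case: (x j); [left|right].
Qed.

Lemma measurable_repetition p n : measurable (repetition p n).
Proof.
rewrite (_ : repetition p n = \bigcap_i [set x | (i < n)%N -> x (p i) = x i]); last first.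
  by apply/seteqP; split => t /= h i; [move=> _|]; apply: h.
apply: bigcapT_measurable => i; case: (ltnP i n) => [_|_]; last first.
  by rewrite (_ : [set _ | _] = setT) //; apply/seteqP; split.
rewrite (_ : [set _ | _] = [set x | x (p i) = x i]); first exact: measurable_coord_eq.
by apply/seteqP; split => x /=; [exact|].
Qed.

(* Each time the window grows past all coordinates read so far, the new
   constraint is independent of the previous ones and halves the measure. *)
Lemma repetition_small p : (forall i, p i <> i) ->
  forall k, exists n, (nu (repetition p n) <= (2^-1 ^+ k)%:E)%E.
Proof.
move=> pfree; elim=> [|k [n IH]].
  exists 0%N; rewrite expr0; exact: probability_le1 (measurable_repetition _ _).
(* All coordinates read by the window [n] lie below [N]. *)
pose N := (n + \max_(i < n) (p i).+1)%N.
have pN i : (i < n)%N -> (p i < N)%N.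
  move=> ni; rewrite /N; apply: leq_trans (leq_addl _ _).
  exact: (leq_bigmax (F := fun i : 'I_n => (p i).+1) (Ordinal ni)).
have nN : (n <= N)%N by exact: leq_addr.
exists N.+1.
(* One of [N] and [p N] is a coordinate [j >= N]: flipping it leaves the old window unchanged and
   toggles the new constraint. *)
have [m [j [jN [mj mjE]]]] : exists m j, (N <= j)%N /\ m <> j /\
    ((m = N /\ j = p N) \/ (m = p N /\ j = N)).
  case: (leqP N (p N)) => h.
    by exists N, (p N); split => //; split; [move=> /esym /pfree|left].
  by exists (p N), N; split => //; split; [exact: pfree|right].
pose H : set coin_space := [set x | x (p N) = x N].
have mH : measurable H. exact: measurable_coord_eq.
have mR := measurable_repetition p n.
apply: (@le_trans _ _ (nu (repetition p n `&` H))).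
  apply: le_measure; rewrite ?inE; [exact: measurable_repetition|exact: measurableI|].
  move=> x xR; split=> [i ni|]; apply: xR => //; lia.
rewrite (measure_halved j) //.
- by rewrite exprS EFinM lee_pmul2l.
- move=> x; have fl i : (i < N)%N -> flip j x i = x i.
    by rewrite /flip => iN; case: eqP => [ij|]; rewrite ?addbF //; lia.
  by split => xR i ni; have := xR i ni; rewrite !fl ?pN //; lia.
- move=> x; rewrite /H /= /flip.
  have pf := pfree N.
  case: mjE => [[_ ->]|[_ ->]]; rewrite eqxx.
    have -> : (N == p N) = false by apply/eqP => e; apply: pf.
    by rewrite addbT addbF; case: (x N); case: (x (p N)); split.
  have -> : (p N == N) = false by apply/eqP.
  by rewrite addbT addbF; case: (x N); case: (x (p N)); split.
Qed.

Lemma repetition_null p : (forall i, p i <> i) ->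
  nu.-negligible [set x : coin_space | permute p x = x].
Proof.
move=> pfree; exists (\bigcap_n repetition p n); split.
- exact: bigcapT_measurable (measurable_repetition p).
- apply/eqP; rewrite eq_le measure_ge0 andbT.
  apply/lee_addgt0Pr => e /half_lt_eps[k ke]; rewrite add0e.
  have [n nk] := repetition_small p pfree k.
  apply: (@le_trans _ _ (nu (repetition p n))); last first.
    by apply: (le_trans nk); rewrite lee_fin ltW.
  apply: le_measure; rewrite ?inE; last by move=> x; apply.
    exact: bigcapT_measurable (measurable_repetition p).
  exact: measurable_repetition.
- by move=> x /= xp n _ i _; rewrite -{2}xp.
Qed.
End CoinInvariance.

(** * Groups as choice types, and elementary identities *)

HB.instance Definition _ (G : group) := gen_eqMixin (gcar G).
HB.instance Definition _ (G : group) := gen_choiceMixin (gcar G).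

Section GroupFacts.
Context {G : group}.
Implicit Types x y z : G.

Lemma gmulKl x y : gmul (ginv x) (gmul x y) = y.
Proof. by rewrite gmulA gmulVl gmul1l. Qed.

Lemma gmulKVl x y : gmul x (gmul (ginv x) y) = y.
Proof. by rewrite gmulA gmulVr gmul1l. Qed.

Lemma gmulKr x y : gmul (gmul y x) (ginv x) = y.
Proof. by rewrite -gmulA gmulVr gmul1r. Qed.

Lemma gmulIl x y z : gmul x y = gmul x z -> y = z.
Proof. by move=> /(congr1 (gmul (ginv x))); rewrite !gmulKl. Qed.

Lemma gmulIr x y z : gmul y x = gmul z x -> y = z.
Proof. by move=> /(congr1 (fun w => gmul w (ginv x))); rewrite !gmulKr. Qed.

Lemma ginvM x y : ginv (gmul x y) = gmul (ginv y) (ginv x).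
Proof. by apply: (gmulIl (gmul x y)); rewrite gmulVr -gmulA gmulKVl gmulVr. Qed.

Lemma ginvK x : ginv (ginv x) = x.
Proof. by apply: (gmulIl (ginv x)); rewrite gmulVr gmulVl. Qed.

Lemma ginv1 : ginv (gone G) = gone G.
Proof. by apply: (gmulIl (gone G)); rewrite gmulVr gmul1l. Qed.

Lemma gpowD x m n : gpow x (m + n) = gmul (gpow x m) (gpow x n).
Proof. by elim: m => [|m IH]; rewrite ?gmul1l // addSn /= IH gmulA. Qed.

End GroupFacts.

(** * Quantitative freeness *)

Section Separation.
Import Order.TTheory GRing.Theory Num.Theory.
Local Close Scope ereal_scope.
Local Open Scope classical_set_scope.
Local Notation R := Rdefinitions.R.

Lemma measure_fibers d (X : measurableType d) (mu : probability X R) (I : finType)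
    (f : X -> I) (P : pred I) (A : set X) :
  measurable A -> (forall i, measurable (f @^-1` [set i])) ->
  fine (mu (A `&` [set x | P (f x)])) =
    \sum_(i | P i) fine (mu (A `&` f @^-1` [set i])).
Proof.
move=> mA mf.
have H (r : seq I) : uniq r -> measurable (A `&` [set x | f x \in r]) /\
   fine (mu (A `&` [set x | f x \in r])) = \sum_(i <- r) fine (mu (A `&` f @^-1` [set i])).
  elim: r => [_|i r IH /= /andP[ir /IH[mr Er]]].
    rewrite (_ : A `&` _ = set0); first by rewrite big_nil measure0.
    by apply/seteqP; split => // x [].
  have mi : measurable (A `&` f @^-1` [set i]) by exact: measurableI.
  rewrite (_ : A `&` _ = (A `&` f @^-1` [set i]) `|` (A `&` [set x | f x \in r])).
    split; first exact: measurableU.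
    rewrite big_cons -Er measureU //; last first.
      by apply/seteqP; split => // x [[_ /= ->] [_ /=]]; rewrite (negPf ir).
    by rewrite fineD //; exact: fin_num_measure.
  apply/seteqP; split => x /=; rewrite inE.
    by move=> [Ax /orP[/eqP ->|fr]]; [left|right].
  by move=> [[Ax ->]|[Ax ->]]; rewrite ?eqxx ?orbT.
have [_] := H (enum P) (enum_uniq _).
rewrite big_enum => Er; apply: etrans Er; congr (fine (mu (_ `&` _))).
by apply/seteqP; split => x /=; rewrite mem_enum.
Qed.

(* A quantitative, finite form of freeness: off a small set, finitely many
   nontrivial elements move every point to another class of a finite Borel
   partition. *)
Definition finitely_separated {G : group} {d} {X : measurableType d}
    (mu : probability X R) (a : G -> X -> X) :=
  forall (I : finType) (P : pred I) (h : I -> G) (e : R),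
    (forall i, P i -> h i <> gone G) -> 0 < e ->
    exists (J : finType) (c : X -> J) (V : set X),
      [/\ measurable V, (mu (~` V) <= e%:E)%E,
        forall j, measurable (c @^-1` [set j]) &
        forall i x, P i -> V x -> c (a (h i) x) <> c x].

(** A union bound over [r], spending half of [e] at each index. One window serves all indices
    because [repetition] shrinks as the window grows. *)
Lemma window_small (I : finType) (P : pred I) (p : I -> nat -> nat) (e : R) (r : seq I) :
  (forall i, P i -> forall n, p i n <> n) -> 0 < e ->
  exists n, measurable [set x | exists i, [/\ i \in r, P i & repetition (p i) n x]] /\
    (@coin_measure R [set x | exists i, [/\ i \in r, P i & repetition (p i) n x]] <= e%:E)%E.
Proof.
move=> pfree; elim: r e => [|i r IH] e e0.
  exists 0%N; rewrite (_ : [set _ | _] = set0); last by apply/seteqP; split => // x [i []].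
  by rewrite measure0 lee_fin ltW.
have [|n [mn en]] := IH (e / 2); first by rewrite divr_gt0.
have widen q k l : (k <= l)%N -> repetition q l `<=` repetition q k.
  by move=> kl x xl j jk; apply: xl; exact: leq_trans kl.
have [Pi|nPi] := boolP (P i); last first.
  exists n; rewrite (_ : [set _ | _] = [set x | exists i, [/\ i \in r, P i & repetition (p i) n x]]).
    by split => //; apply: (le_trans en); rewrite lee_fin; lra.
  apply/seteqP; split => x /= [j [jr Pj Rj]]; exists j; split => //.
    by move: jr nPi; rewrite inE => /orP[/eqP <-|//]; rewrite Pj.
  by rewrite inE jr orbT.
have [k ke] := @half_lt_eps R (e / 2) ltac:(lra).
have [m mk] := @repetition_small R (p i) (pfree i Pi) k.
set S := fun n => [set x | exists j, [/\ j \in r, P j & repetition (p j) n x]].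
have mS l : measurable (S l : set coin_space).
  rewrite (_ : S l = \big[setU/set0]_(j <- r | P j) repetition (p j) l).
    by apply: bigsetU_measurable => j _; exact: measurable_repetition.
  rewrite -bigcup_seq_cond; apply/seteqP; split => x /=.
    by move=> [j [jr Pj Rj]]; exists j => //=; rewrite jr.
  by move=> [j /= /andP[jr Pj] Rj]; exists j.
exists (maxn m n).
rewrite (_ : [set _ | _] = repetition (p i) (maxn m n) `|` S (maxn m n)); last first.
  apply/seteqP; split => x /=.
    by move=> [j []]; rewrite inE => /orP[/eqP -> _ Rj|jr Pj Rj]; [left|right; exists j].
  by move=> [Ri|[j [jr Pj Rj]]]; [exists i; rewrite inE eqxx|exists j; rewrite inE jr orbT].
have mR := measurable_repetition (p i) (maxn m n).
split; first exact: measurableU.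
apply: (@le_trans _ _ (@coin_measure R (repetition (p i) (maxn m n))
    + @coin_measure R (S (maxn m n)))%E).
  exact: measureU2.
rewrite (_ : e = e / 2 + e / 2); last by lra.
rewrite EFinD; apply: leeD.
  apply: (@le_trans _ _ (2^-1 ^+ k)%:E); last by rewrite lee_fin ltW.
  apply: le_trans mk; apply: le_measure; rewrite ?inE //; first exact: measurable_repetition.
  by apply: widen; exact: leq_maxl.
apply: le_trans en; apply: le_measure; rewrite ?inE //.
by move=> x [j [jr Pj Rj]]; exists j; split => //; apply: widen Rj; exact: leq_maxr.
Qed.
End Separation.

(** * The Bernoulli action of a countably infinite group *)

Section CoinAction.
Import Order.TTheory GRing.Theory Num.Theory.
Local Close Scope ereal_scope.
Local Open Scope classical_set_scope.
Local Notation R := Rdefinitions.R.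
Context (G : group) (code : G -> nat) (decode : nat -> G).
Hypothesis codeK : cancel code decode.
Hypothesis decodeK : cancel decode code.

(** Translation read through the numbering of [G]; the inverse makes [coin_action] a left action. *)
Definition shift (g : G) (n : nat) : nat := code (gmul (ginv g) (decode n)).

Definition coin_action (g : G) : coin_space -> coin_space := permute (shift g).

Lemma shift_inj g : injective (shift g).
Proof.
by move=> m n /(can_inj codeK)/gmulIl/(can_inj decodeK).
Qed.

Lemma shift_free g : g <> gone G -> forall n, shift g n <> n.
Proof.
move=> g1 n /(congr1 decode); rewrite /shift codeK => h; apply: g1.
rewrite -[g]ginvK -[RHS]ginv1; congr ginv.
by apply: (gmulIr (decode n)); rewrite gmul1l.
Qed.

Lemma coin_action_pmp : pmp_action (@coin_measure R) coin_action.
Proof.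
split; [|split; [|split]].
- move=> x; apply/funext => n.
  by rewrite /coin_action /permute /shift ginv1 gmul1l decodeK.
- move=> g h x; apply/funext => n.
  by rewrite /coin_action /permute /shift codeK ginvM gmulA.
- move=> g; exact: measurable_permute.
- move=> g A mA; apply: permute_preserving => //; exact: shift_inj.
Qed.

Lemma coin_action_free : as_free (@coin_measure R) coin_action.
Proof.
rewrite /as_free (_ : [set _ | _] =
    \bigcup_n [set x | decode n <> gone G /\ coin_action (decode n) x = x]).
  apply: negligible_bigcup => n.
  have [n1|n1] := pselect (decode n = gone G).
    rewrite (_ : [set _ | _] = set0); first exact: negligible_set0.
    by apply/seteqP; split => // x [].
  apply: negligibleS (@repetition_null R _ (shift_free _ n1)).
  by move=> x [].
apply/seteqP; split => x /=; first by move=> [g gx]; exists (code g) => //=; rewrite codeK.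
by move=> [n _ /= nx]; exists (decode n).
Qed.

(** The classes are given by the first [n] coordinates. Outside the small set of [window_small],
    every [h i] changes one of these coordinates. *)
Lemma coin_action_separated : finitely_separated (@coin_measure R) coin_action.
Proof.
move=> I P h e h1 e0.
have [|n [mV Ve]] := @window_small I P (fun i => shift (h i)) e (enum I) _ e0.
  by move=> i /h1/shift_free.
exists (n.-tuple bool : finType), (fun x => [tuple x i | i < n]).
exists (~` [set x | exists i, [/\ i \in enum I, P i & repetition (shift (h i)) n x]]); split.
- exact: measurableC.
- by rewrite setCK.
- move=> t; rewrite (_ : _ @^-1` _ = cylinder t); first exact: measurable_cylinder.
  rewrite cylinderE size_tuple; apply/seteqP; split => x /=.
    by move=> <- i ni; rewrite (nth_mktuple _ _ (Ordinal ni)).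
  move=> xt; apply: eq_from_tnth => i; rewrite tnth_mktuple xt //.
  by rewrite (tnth_nth false).
- move=> i x Pi Vx /(congr1 (@tnth _ _)) E; apply: Vx; exists i; split => //.
    exact: mem_enum.
  by move=> k kn; have := congr1 (fun f => f (Ordinal kn)) E; rewrite !tnth_mktuple.
Qed.
End CoinAction.

(** * Cost and the number of lines *)

Section Lines.
Local Close Scope ereal_scope.
Local Close Scope ring_scope.
Local Open Scope fset_scope.
Local Open Scope nat_scope.
Context {G : group}.
Implicit Types (z g h : G) (A B : {fset G}).

(** [gpow] has natural exponents only, so the two cases account for both signs. *)
Definition same_line z g h := exists n, h = gmul (gpow z n) g \/ g = gmul (gpow z n) h.

Definition line z g : set G := [set h | same_line z g h]%classic.

Definition lines z B : {fset (set G)} := [fset line z g | g in B].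

Definition mulf A B : {fset G} := [fset gmul g h | g in A, h in B].

Lemma same_line_sym z g h : same_line z g h -> same_line z h g.
Proof. by move=> [n [->|->]]; exists n; [right|left]. Qed.

Lemma gpow_sub z m n g h : m <= n -> gmul (gpow z n) g = gmul (gpow z m) h ->
  h = gmul (gpow z (n - m)) g.
Proof.
move=> mn; rewrite -{1}(subnKC mn) gpowD -gmulA => /gmulIl; exact: esym.
Qed.

Lemma same_line_trans z g h k : same_line z g h -> same_line z h k -> same_line z g k.
Proof.
move=> [m [hE|gE]] [n [kE|hE']].
- by exists (n + m); left; rewrite kE hE gpowD gmulA.
- have E : gmul (gpow z m) g = gmul (gpow z n) k by rewrite -hE -hE'.
  have [mn|/ltnW nm] := leqP m n.
    by exists (n - m); right; apply: gpow_sub (esym E).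
  by exists (m - n); left; apply: gpow_sub E.
- have [mn|/ltnW nm] := leqP m n.
    exists (n - m); left.
    by rewrite kE gE gmulA -gpowD subnK.
  by exists (m - n); right; rewrite kE gE gmulA -gpowD subnK.
- by exists (m + n); right; rewrite gE hE' gpowD gmulA.
Qed.

Lemma line_refl z g : line z g g.
Proof. by exists 0; left; rewrite gmul1l. Qed.

Lemma lineP z g h : line z g = line z h <-> same_line z g h.
Proof.
split=> [E|gh]; first by have := line_refl z h; rewrite -E.
apply/seteqP; split => k /=.
  exact/same_line_trans/same_line_sym.
exact: same_line_trans.
Qed.

Lemma in_lines z B g : g \in B -> line z g \in lines z B.
Proof. by move=> gB; apply/imfsetP; exists g. Qed.

Lemma in_mulf A B g h : g \in A -> h \in B -> gmul g h \in mulf A B.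
Proof. by move=> gA hB; apply/imfset2P; exists g => //; exists h. Qed.
End Lines.

(** * Graphings made of all lines and some generator edges *)

Section Cost.
Import Order.TTheory GRing.Theory Num.Theory.
Local Close Scope ereal_scope.
Local Open Scope classical_set_scope.
Local Notation R := Rdefinitions.R.
Context {G : group} {d : measure_display} {X : measurableType d}
  (mu : probability X R) (a : G -> X -> X).
Hypothesis a_pmp : pmp_action mu a.
Context (z : G) {k : nat} (s : 'I_k -> G).
Implicit Types (E : 'I_k -> set X) (x y : X).

(* The edges [x -> z x] alone cost 1, so a cost above 1 keeps the volume of the
   sets [E i] away from 0. *)
Definition partial_edge E : X -> X -> Prop :=
  fun x y => y = a z x \/ exists i, E i x /\ y = a (s i) x.

(** Asked at every point, so that no null set has to be carried along when edges are removed. *)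
Definition spanning E :=
  forall x g, clos_refl_sym_trans X (partial_edge E) x (a g x).

Definition volume E : R := \sum_i fine (mu (E i)).

Let a1 x : a (gone G) x = x. Proof. by case: a_pmp. Qed.
Let aM g h x : a (gmul g h) x = a g (a h x). Proof. by case: a_pmp => _ []. Qed.
Let aVK g x : a (ginv g) (a g x) = x. Proof. by rewrite -aM gmulVl a1. Qed.
Let aKV g x : a g (a (ginv g) x) = x. Proof. by rewrite -aM gmulVr a1. Qed.
Let ma g : measurable_fun [set: X] (a g). Proof. by case: a_pmp => _ [_ []]. Qed.
Let mupre g A : measurable A -> mu (a g @^-1` A) = mu A.
Proof. by case: a_pmp => _ [_ [_]]; apply. Qed.

Lemma measurable_preim g A : measurable A -> measurable (a g @^-1` A).
Proof. by move=> mA; rewrite -[_ @^-1` _]setTI; exact: ma. Qed.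

Lemma action_image g A : a g @` A = a (ginv g) @^-1` A.
Proof.
apply/seteqP; split => [_ [x Ax <-]|x /= Ax]; first by rewrite /= aVK.
by exists (a (ginv g) x).
Qed.

Lemma action_cost_le E : (forall i, measurable (E i)) -> spanning E ->
  (action_cost mu a <= (1 + volume E)%:E)%E.
Proof.
move=> mE cE.
(* Index 0 carries [z] on the whole space and accounts for the cost 1; index [i.+1] carries [s i] on
   [E i], and all later domains are empty. *)
pose A n := if n is m.+1 then (if insub m is Some i then E i else set0) else setT.
pose phi n := a (if n is m.+1 then (if insub m is Some i then s i else gone G) else z).
have mA n : measurable (A n) by case: n => //= m; case: insubP.
apply: (@le_trans _ _ (graphing_cost mu A)).
  apply: ereal_inf_lbound; exists A, phi; split => //.
  split => //; split; last split; last split; last split; last split.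
  - by move=> n; rewrite action_image; exact: measurable_preim.
  - by move=> n; apply: measurable_funS (ma _).
  - by move=> n x y _ _; rewrite /phi; set c := (X in a X x);
      move=> /(congr1 (a (ginv c))); rewrite !aVK.
  - by move=> n S mS _; rewrite action_image; exact: measurable_preim.
  - by move=> n x _; eexists.
  - rewrite (_ : [set _ | _] = set0); first exact: negligible_set0.
    apply/seteqP; split => // x /=; apply => g.
    elim: (cE x g) => [{}x y|{}x|{}x y _ IH|{}x y w _ IH1 _ IH2].
    + move=> [->|[i [Ei ->]]]; apply: rst_step; first by exists 0%N.
      by exists i.+1; rewrite /A /phi /= insubT //= => ik;
        rewrite (_ : Sub _ _ = i) //; apply: val_inj.
    + exact: rst_refl.
    + exact: rst_sym.
    + exact: rst_trans IH1 IH2.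
rewrite /graphing_cost (nneseries_split 0 k.+1) // add0n.
rewrite [X in (_ + X)%E](_ : _ = 0%E); last first.
  apply: eseries0 => i ki _; case: i ki => //= m km.
  by rewrite insubF ?measure0 //; apply/negbTE; rewrite -leqNgt.
rewrite adde0 big_nat_recl // big_mkord /= probability_setT EFinD /volume -sumEFin.
rewrite leeD2l // le_eqVlt; apply/orP; left; apply/eqP; apply: eq_bigr => i _.
rewrite insubT //= => ik; rewrite (_ : Sub _ _ = i); last exact: val_inj.
by rewrite fineK //; exact: fin_num_measure.
Qed.

Lemma same_line_connected E x g h : same_line z g h ->
  clos_refl_sym_trans X (partial_edge E) (a g x) (a h x).
Proof.
have H n y : clos_refl_sym_trans X (partial_edge E) y (a (gpow z n) y).
  elim: n => [|n IH]; first by rewrite a1; exact: rst_refl.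
  by apply: rst_trans IH _; apply: rst_step; left; rewrite -aM.
move=> [n [->|->]]; rewrite aM; first exact: H.
by apply: rst_sym; exact: H.
Qed.

(** At each point of [Z] the edges [L] form the same multigraph on the lines [F]. It has more edges
    than vertices, so one edge is redundant; it can be deleted at all points of [Z] at once, as
    their copies of [B] do not interfere. *)
Lemma remove_edge E (B : {fset G}) (F : {fset (set G)}) (L : {set 'I_k * B}) (Z : set X) :
  (forall i, measurable (E i)) -> spanning E -> measurable Z ->
  (forall b, b \in B -> line z b \in F /\ forall i, line z (gmul (s i) b) \in F) ->
  (#|` F| < #|L|)%N ->
  (forall x t, Z x -> t \in L -> E t.1 (a (val t.2) x)) ->
  (forall x b b', Z x -> b \in B -> b' \in B -> b <> b' ->
     ~ Z (a (gmul (ginv b) b') x)) ->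
  exists E', [/\ (forall i, measurable (E' i)), spanning E' &
                 volume E' = volume E - fine (mu Z)].
Proof.
move=> mE cE mZ BF FL ZL Zsep.
pose u (t : 'I_k * B) : F := [` (BF _ (valP t.2)).1 ]%fset.
pose v (t : 'I_k * B) : F := [` (BF _ (valP t.2)).2 t.1 ]%fset.
have [|[i0 b0] tL conn] := @redundant_edge _ _ u v L; first by rewrite -cardfE.
pose g0 := val b0.
pose E' i := if i == i0 then E i `\` (a (ginv g0) @^-1` Z) else E i.
have mE' i : measurable (E' i).
  rewrite /E'; case: ifP => // _; apply: measurableD => //; exact: measurable_preim.
exists E'; split => //.
(* An edge at [w] could only be deleted on behalf of the point [a (gmul (ginv g0) b) w] of [Z],
   which separation excludes unless [b] is [b0]. *)
- have kept w (i : 'I_k) (b : B) : Z w -> (i, b) \in L :\ (i0, b0) -> E' i (a (val b) w).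
    move=> Zw; rewrite !inE => /andP[neq tL']; have /= Ew := ZL _ _ Zw tL'.
    rewrite /E'; case: eqP => // ii; split => //=; rewrite -aM.
    apply: Zsep => //; try exact: valP.
    by move=> /val_inj bb; move: neq; rewrite ii bb eqxx.
  pose r := edge_rel u v (L :\ (i0, b0)).
  have loop w : Z w -> clos_refl_sym_trans X (partial_edge E') (a g0 w) (a (s i0) (a g0 w)).
    move=> Zw.
    (* The lines whose points are all still connected to [a g0 w]: closed under the remaining edges
       and containing the line of [g0], hence also that of the far end of the deleted edge. *)
    pose Q : pred F := fun q => `[< forall h, line z h = val q ->
      clos_refl_sym_trans X (partial_edge E') (a g0 w) (a h w) >].
    have rsym : symmetric r.
      by move=> p q; apply/existsP/existsP => -[t Ht]; exists t; rewrite orbC.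
    have Qclosed : fingraph.closed r Q.
      apply: intro_closed; first exact: sym_connect_sym.
      move=> p q /existsP[[i b] /andP[tL' /orP[|] /andP[/eqP ui /eqP vi]]] /asboolP Qp;
        apply/asboolP => h hq.
        have pE : val p = line z (val b) by rewrite -ui.
        have qE : val q = line z (gmul (s i) (val b)) by rewrite -vi.
        apply: rst_trans (Qp _ (esym pE)) _.
        apply: (rst_trans _ _ _ (a (gmul (s i) (val b)) w)).
          apply: rst_step; right; exists i; split; last by rewrite aM.
          exact: kept.
        by apply: same_line_connected; apply/lineP; rewrite hq.
      have pE : val p = line z (gmul (s i) (val b)) by rewrite -vi.
      have qE : val q = line z (val b) by rewrite -ui.
      apply: rst_trans (Qp _ (esym pE)) _.
      apply: (rst_trans _ _ _ (a (val b) w)).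
        apply: rst_sym; apply: rst_step; right; exists i; split; last by rewrite aM.
        exact: kept.
      by apply: same_line_connected; apply/lineP; rewrite hq.
    have Q0 : u (i0, b0) \in Q.
      by apply/asboolP => h /= hq; apply: same_line_connected; apply/lineP.
    have : v (i0, b0) \in Q by rewrite -(closed_connect Qclosed conn).
    by move=> /asboolP Qv; rewrite -aM; apply: Qv.
  move=> x g; elim: (cE x g) => [{}x y|{}x|{}x y _ IH|{}x y w _ IH1 _ IH2].
  + move=> [->|[i [Ei ->]]]; first by apply: rst_step; left.
    have [[ii Zx]|nZ] := pselect (i = i0 /\ Z (a (ginv g0) x)).
      by have := loop _ Zx; rewrite ii aKV.
    apply: rst_step; right; exists i; split => //; rewrite /E'.
    by case: eqP => // ii; split => // Zx; apply: nZ.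
  + exact: rst_refl.
  + exact: rst_sym.
  + exact: rst_trans IH1 IH2.
rewrite /volume (bigD1 i0) //= [in RHS](bigD1 i0) //= addrAC; congr (_ + _); last first.
  by apply: eq_bigr => i ii; rewrite /E' (negPf ii).
rewrite /E' eqxx.
have mZ' : measurable (a (ginv g0) @^-1` Z) by exact: measurable_preim.
have ZE : a (ginv g0) @^-1` Z `<=` E i0.
  by move=> x /= Zx; have := ZL _ _ Zx tL; rewrite /= aKV.
have fZ : mu Z \is a fin_num by exact: fin_num_measure.
have fE : mu (E i0) \is a fin_num by exact: fin_num_measure.
rewrite measureD //; last by rewrite -ge0_fin_numE.
rewrite setIidr // -(mupre (ginv g0) Z mZ) fineB //.
exact: fin_num_measure.
Qed.
(** For a nearly minimal [E], consider the random set of generator edges starting in the copy of [B]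
    at [x]. Its mean size is the volume times the size of [B], and by [remove_edge] it rarely
    exceeds the size of [F]. *)
Lemma volume_le_lines (m : R) (B : {fset G}) (F : {fset (set G)}) :
  finitely_separated mu a ->
  (forall E, (forall i, measurable (E i)) -> spanning E -> m <= volume E) ->
  (forall e, 0 < e -> exists E, [/\ forall i, measurable (E i), spanning E &
     volume E < m + e]) ->
  (forall b, b \in B -> line z b \in F /\ forall i, line z (gmul (s i) b) \in F) ->
  m * (#|` B|)%:R <= (#|` F|)%:R.
Proof.
move=> a_sep m_min m_inf BF; apply/ler_addgt0Pr => e e0.
pose T : finType := ('I_k * B)%type.
pose C : R := #|T|%:R; pose N : R := #|{set T}|%:R.
have C0 : 0 <= C by rewrite ler0n.
have N0 : 0 <= N by rewrite ler0n.
have CN0 : 0 <= C * N by rewrite mulr_ge0.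
have CN1 : 0 < C * N + 1 by lra.
(* There are [N] patterns of at most [C] edges. Those that are too large have measure at most
   [2 * e1] each, so they contribute at most [e] in all. *)
pose e1 := e / (2 * (C * N + 1)).
have e10 : 0 < e1 by rewrite divr_gt0 // mulr_gt0.
have [J [c [V [mV Ve mc csep]]]] := a_sep (B * B)%type (fun p => p.1 != p.2)
  (fun p => gmul (ginv (val p.1)) (val p.2)) e1
  ltac:(by move=> [b b'] /= /eqP bb E; apply: bb; apply: val_inj;
        move: (congr1 (gmul (val b)) E); rewrite gmulKVl gmul1r) e10.
(* Each of the [J] classes may lose [e2], which adds up to at most [e1]. *)
pose e2 := e1 / (#|J|%:R + 1).
have J0 : 0 <= (#|J|%:R : R) by rewrite ler0n.
have J1 : 0 < (#|J|%:R + 1 : R) by lra.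
have e20 : 0 < e2 by rewrite divr_gt0.
have Je2 : #|J|%:R * e2 <= e1.
  rewrite /e2 mulrCA -[leRHS]mulr1 ler_pM2l // ler_pdivrMr // mul1r.
  by rewrite lerDl.
have [E [mE cE volE]] := m_inf _ e20.
pose Lx x : {set T} := [set t : T | `[< E t.1 (a (val t.2) x) >]]%SET.
have mpre (t : T) : measurable (a (val t.2) @^-1` E t.1).
  exact: measurable_preim.
have mL L : measurable (Lx @^-1` [set L]).
  rewrite (_ : _ @^-1` _ = \bigcap_(t in [set: T])
      (if t \in L then a (val t.2) @^-1` E t.1 else ~` (a (val t.2) @^-1` E t.1))).
    apply: fin_bigcap_measurable; first exact: finite_finset.
    by move=> t _; case: ifP => _ //; exact: measurableC.
  apply/seteqP; split => x /=.
    by move=> <- t _; rewrite inE; case: asboolP.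
  move=> H; apply/setP => t; rewrite inE; have := H t I.
  by case: ifP => _ tx; [apply/asboolP|apply/negbTE/asboolPn].
pose p L : R := fine (mu (setT `&` Lx @^-1` [set L])).
have p0 L : 0 <= p L by rewrite fine_ge0.
have pt t : fine (mu (E t.1)) = \sum_(L : {set T} | t \in L) p L.
  rewrite -(measure_fibers _ _ mu _ Lx (fun L => t \in L)) // setTI.
  rewrite -(mupre (val t.2) _ (mE t.1)).
  congr (fine (mu _)); apply/seteqP; split => x /=; rewrite inE; first by move/asboolP.
  by move=> /asboolP.
have p1 : \sum_(L : {set T}) p L = 1.
  rewrite -(measure_fibers _ _ mu _ Lx predT) // setTI.
  by rewrite (_ : [set _ | _] = setT) ?probability_setT //; apply/seteqP; split.
have pbig (L : {set T}) : (#|` F| < #|L|)%N -> p L <= 2 * e1.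
  move=> FL; rewrite /p setTI.
  have mA : measurable (V `&` Lx @^-1` [set L]) by exact: measurableI.
  have small : fine (mu (V `&` Lx @^-1` [set L])) <= e1.
    rewrite (_ : V `&` _ = (V `&` Lx @^-1` [set L]) `&` [set x | predT (c x)]); last first.
      by apply/seteqP; split => x //= [].
    rewrite measure_fibers //.
    apply: le_trans Je2; rewrite mulr_natl -sumr_const; apply: ler_sum => j _.
    (* Within one class of [c] on [V] the copies of [B] are separated, so deleting an edge over [Z]
       is allowed; the minimality of [m] then bounds the measure of [Z] by [e2]. *)
    set Z := _ `&` _ `&` _.
    have mZ : measurable Z by exact: measurableI.
    have [x [i b] [[_ /= xL] _] tL|x b b' [[Vx _] cx] bB b'B bb|E' [mE' cE' vE']] :=
      remove_edge E B F L Z mE cE mZ BF FL.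
    - by move: tL; rewrite -xL inE => /asboolP.
    - move=> [[_ _]] /= cx'.
      apply: (csep ([` bB]%fset, [` b'B]%fset) x _ Vx).
        by apply/eqP => /(congr1 val).
      by rewrite /= cx' cx.
    - have := m_min _ mE' cE'; rewrite vE'; lra.
  have fin A : measurable A -> mu A \is a fin_num by move=> ?; exact: fin_num_measure.
  have mVC : measurable (~` V) by exact: measurableC.
  rewrite -lee_fin fineK; last exact: fin.
  apply: (@le_trans _ _ (mu (V `&` Lx @^-1` [set L]) + mu (~` V))%E).
    apply: le_trans (measureU2 mu mA mVC).
    apply: le_measure; rewrite ?inE //; first exact: measurableU.
    by move=> x xL; have [Vx|] := pselect (V x); [left|right].
  rewrite mulr_natl mulr2n EFinD; apply: leeD => //.
  by rewrite -[leLHS]fineK ?lee_fin //; exact: fin.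
(* Double counting: the mean pattern size, summed over edges and over patterns. *)
have sumE : (#|` B|)%:R * volume E = \sum_(L : {set T}) #|L|%:R * p L.
  transitivity (\sum_(t : T) fine (mu (E t.1))).
    rewrite -(pair_bigA _ (fun i (b : B) => fine (mu (E i)))) /= mulr_sumr.
    by apply: eq_bigr => i _; rewrite sumr_const -cardfE mulr_natl.
  under eq_bigr do rewrite pt.
  rewrite (exchange_big_dep predT) //=; apply: eq_bigr => L _.
  by rewrite sumr_const mulr_natl; congr (_ *+ _); apply: eq_card => t; rewrite !inE.
apply: (@le_trans _ _ ((#|` B|)%:R * volume E)).
  by rewrite mulrC ler_wpM2l ?ler0n // m_min.
have Ce1 : 0 <= C * (2 * e1) by rewrite mulr_ge0 // mulr_ge0 // ltW.
rewrite sumE; apply: (@le_trans _ _ (\sum_(L : {set T}) ((#|` F|)%:R * p L + C * (2 * e1)))).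
  apply: ler_sum => L _; have [LF|FL] := leqP #|L| #|` F|.
    apply: (@le_trans _ _ ((#|` F|)%:R * p L)); first by rewrite ler_wpM2r ?ler_nat.
    by rewrite lerDl.
  apply: (@le_trans _ _ (C * (2 * e1))); last by rewrite lerDr mulr_ge0.
  by rewrite ler_pM // ?pbig // ler_nat max_card.
rewrite big_split /= -mulr_sumr p1 mulr1 lerD2l sumr_const -[leLHS]mulr_natl.
set N' := #|_|%:R; have -> : N' = N by congr _%:R; exact: eq_card.
rewrite (_ : N * _ = C * N * (2 * e1)); last by ring.
rewrite /e1 [2 * (e / _)]mulrCA invfM [2 * (_ * _)]mulrA mulfV // mul1r mulrCA.
by rewrite ger_pMr // ler_pdivrMr // mul1r lerDl.
Qed.
End Cost.

(** * Paradoxical decompositions *)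

Section InfiniteOrder.
Local Close Scope ereal_scope.
Local Close Scope ring_scope.
Local Open Scope fset_scope.
Local Open Scope nat_scope.
Context {G : group}.

Definition infinite_order (z : G) := forall n, 0 < n -> gpow z n <> gone G.

Lemma gpow_inj (z : G) : infinite_order z -> injective (gpow z).
Proof.
move=> zinf m n; wlog mn : m n / m <= n.
  by move=> H; have [/H//|/ltnW/H] := leqP m n; move=> H' /esym/H'.
move=> E; apply/eqP; rewrite eqn_leq mn /= leqNgt; apply/negP => lt.
apply: (zinf (n - m)); first by rewrite subn_gt0.
by apply: (gmulIl (gpow z m)); rewrite -gpowD subnKC // gmul1r.
Qed.

Lemma finitely_generated_gens : finitely_generated G ->
  exists k (s : 'I_k -> G), forall x, exists w : seq (bool * 'I_k),
    x = foldr (fun p acc => gmul (if p.1 then ginv (s p.2) else s p.2) acc) (gone G) w.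
Proof.
move=> [S genS]; exists (size S), (fun i => nth (gone G) S i) => x.
have [w [Sw ->]] := genS x; elim: Sw => [|[b g] w' /= Sg _ [v IH]]; first by exists [::].
have gS : g \in S.
  move: Sg; elim: S {genS v IH x} => //= h S IH [->|/IH]; rewrite inE ?eqxx // => ->.
  by rewrite orbT.
exists ((b, Ordinal (n := size S) (m := index g S) ltac:(by rewrite index_mem)) :: v).
by rewrite /= nth_index // IH.
Qed.

(** Words in the generators make [G] countable, the powers of a non-torsion element make it
    infinite. *)
Lemma countable_coding : finitely_generated G -> ~ torsion G ->
  exists (code : G -> nat) (decode : nat -> G), cancel code decode /\ cancel decode code.
Proof.
move=> /finitely_generated_gens[k [s gen]] /existsNP[z /forallNP zinf].
have cG : countable [set: G].
  apply: (card_le_trans _ (countableP [set: seq (bool * 'I_k)])).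
  pose f (w : seq (bool * 'I_k)) := foldr (fun p acc =>
    gmul (if p.1 then ginv (s p.2) else s p.2) acc) (gone G) w.
  apply: card_le_trans (card_image_le f setT).
  rewrite (_ : (f @` setT)%classic = setT) //.
  by apply/seteqP; split => // x _; have [w ->] := gen x; exists w.
have iG : infinite_set [set: G].
  apply/infiniteP; apply: (@card_le_trans _ _ _ (gpow z @` setT)%classic); last first.
    exact: subset_card_le.
  have : (gpow z @` setT #= [set: nat])%card%classic.
    by apply: inj_card_eq => m n _ _; apply: gpow_inj => i i0 zi; apply: (zinf i).
  by rewrite card_eq_le => /andP[].
have /card_set_bijP[f [_ finj fsurj]] := eq_card_nat cG iG.
have g n : {x | f x = n} by apply: cid; have [x _ <-] := fsurj n I; exists x.
exists f, (fun n => sval (g n)); split => [x|n]; last exact: svalP (g n).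
by apply: finj; rewrite ?inE //; exact: svalP (g (f x)).
Qed.
End InfiniteOrder.

(** * From injections to paradoxical decompositions *)

Section Paradox.
Local Close Scope ereal_scope.
Local Close Scope ring_scope.
Local Open Scope nat_scope.
Local Open Scope classical_set_scope.
Context {G : group}.

(** If a single translated piece covers [G], that piece is [G] itself, and nothing is left for the
    other family. *)
Lemma paradox_half_ge2 k : has_paradox_half G k -> 2 <= k.
Proof.
move=> [m [n [P [Q [g [h [m0 [n0 [disj [covP [covQ ->]]]]]]]]]]].
have dPQ i j x : P i x -> Q j x -> False.
  move=> Px Qx; have E : P i `&` Q j = set0 by exact: (disj (inl i) (inr j)).
  by have : (P i `&` Q j) x by []; rewrite E.
have all1 l (S : 'I_l -> set G) f (i : 'I_l) : l < 2 ->
    [set: G] = \bigcup_(i in [set: 'I_l]) rtrans (S i) (f i) -> forall x, S i x.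
  move=> l2 E x; have sub j : j = i.
    by have := ltn_ord i; have := ltn_ord j; move=> *; apply: val_inj => /=; lia.
  have : [set: G] (gmul x (f i)) by [].
  by rewrite E => -[j _ [y Sy]]; rewrite (sub j) in Sy * => /gmulIr <-.
have someP : exists i x, P i x.
  have : [set: G] (gone G) by []. rewrite covP => -[i _ [x Px _]]; by exists i, x.
have someQ : exists i x, Q i x.
  have : [set: G] (gone G) by []. rewrite covQ => -[i _ [y Py _]]; by exists i, y.
rewrite leq_min; apply/andP; split; rewrite leqNgt; apply/negP => l2.
  have [j [y Qy]] := someQ; exact: dPQ (all1 _ P g (Ordinal m0) l2 covP y) Qy.
have [j [y Py]] := someP; exact: dPQ Py (all1 _ Q h (Ordinal n0) l2 covQ y).
Qed.

(* Along each line [<z> x] the map [f1] pushes forward the points lying at or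
   after the unique point of [f2]'s image, so it avoids that image. *)
Lemma paradox_half2 (z : G) (K : seq G) (q f : G -> G) : infinite_order z ->
  injective f -> (forall x, q x \in K) -> (forall x, f x = gmul (q x) x) ->
  (forall x y, same_line z (f x) (f y) -> x = y) ->
  has_paradox_half G 2.
Proof.
move=> zinf finj qK fq fline.
pose after x := exists n y, x = gmul (gpow z n) (f y).
pose f1 x := if `[< after x >] then gmul z x else x.
have gpow0 n y : gmul (gpow z n) y = y -> n = 0.
  case: n => // n E; case: (zinf n.+1 isT).
  by apply: (gmulIr y); rewrite gmul1l.
(* A marked point lies at or after itself and is pushed away; a value of [f1] equal to [f y] would
   put two marked points on one line or make a positive power of [z] trivial. *)
have f1f x y : f1 x <> f y.
  rewrite /f1; case: asboolP => [[n [y' ->]] E|nx E]; last first.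
    by apply: nx; exists 0, y; rewrite gmul1l.
  have E' : f y = gmul (gpow z n.+1) (f y') by rewrite -E /= gmulA.
  have yy : y' = y by apply: fline; exists n.+1; left.
  by move: E'; rewrite yy => /esym/gpow0.
have f1inj : injective f1.
  have cross x y : after x -> ~ after y -> gmul z x <> y.
    move=> [n [w xE]] ny E; apply: ny; exists n.+1, w.
    by rewrite -E xE /= gmulA.
  move=> x y; rewrite /f1; case: asboolP => hx; case: asboolP => hy //.
  - exact: gmulIl.
  - by move/(cross _ _ hx hy).
  - by move/esym/(cross _ _ hy hx).
(* The maps multiply on the left while the pieces are translated on the right, hence the inverses:
   multiplying [ginv (f1 x)] by [z] or 1 gives [ginv x]. *)
pose P (i : 'I_2) : set G := [set p | exists x, p = ginv (f1 x) /\ ((i : nat) = 1 <-> after x)].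
pose Q (j : 'I_(size K)) : set G := [set p | exists x, p = ginv (f x) /\ index (q x) K = j].
have ginv_inj : injective (@ginv G) := can_inj ginvK.
(* The lower bound 2 on half numbers then turns the minimum into 2. *)
suff H : has_paradox_half G (minn 2 (size K)).
  by have := H; have := paradox_half_ge2 _ H; rewrite leq_min => /= K2; rewrite (minn_idPl K2).
exists 2, (size K), P, Q, (fun i => if i == 1 :> nat then z else gone G),
  (fun j => nth (gone G) K j); split => //; split.
  have := qK (gone G); by case: K {qK Q}.
split; last split; last split => //.
- move=> F [i|i] [j|j] ij; apply/seteqP; split => // p [].
  + move=> [x [-> ix]] [y [/ginv_inj/f1inj <- jx]]; apply: ij; congr inl; apply: val_inj => /=.
    have [ax|nax] := pselect (after x); first by rewrite (iffRL ix ax) (iffRL jx ax).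
    have i1 : (i : nat) <> 1 by move=> /ix.
    have j1 : (j : nat) <> 1 by move=> /jx.
    have := ltn_ord i; have := ltn_ord j; lia.
  + by move=> [x [-> _]] [y [/ginv_inj/f1f]].
  + by move=> [x [-> _]] [y [/ginv_inj/esym/f1f]].
  + move=> [x [-> ix]] [y [/ginv_inj/finj <- jx]]; apply: ij; congr inr; apply: val_inj.
    by rewrite /= -ix -jx.
- apply/seteqP; split => // y _; have [ax|nax] := pselect (after (ginv y)).
    exists (Ordinal (isT : 1 < 2)) => //; exists (ginv (f1 (ginv y))).
      by exists (ginv y); split.
    by rewrite /f1; case: asboolP => // _; rewrite ginvM ginvK /= -gmulA gmulVl gmul1r.
  exists (Ordinal (isT : 0 < 2)) => //; exists (ginv (f1 (ginv y))).
    by exists (ginv y); split.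
  by rewrite /f1; case: asboolP => // _; rewrite ginvK /= gmul1r.
- apply/seteqP; split => // y _.
  have iK : index (q (ginv y)) K < size K by rewrite index_mem.
  exists (Ordinal iK) => //; exists (ginv (f (ginv y))); first by exists (ginv y).
  by rewrite /= nth_index // fq ginvM ginvK -gmulA gmulVl gmul1r.
Qed.
End Paradox.

(** * From cost to an isoperimetric inequality for lines *)

Section CostIsoperimetry.
Import Order.TTheory GRing.Theory Num.Theory.
Local Close Scope ereal_scope.
Local Open Scope classical_set_scope.
Local Notation R := Rdefinitions.R.
Context {G : group}.

Lemma spanning_full d (X : measurableType d) (mu : probability X R) (a : G -> X -> X)
    (z : G) k (s : 'I_k -> G) : pmp_action mu a ->
  (forall x, exists w : seq (bool * 'I_k),
    x = foldr (fun p acc => gmul (if p.1 then ginv (s p.2) else s p.2) acc) (gone G) w) ->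
  spanning a z s (fun=> setT).
Proof.
move=> [a1 [aM _]] gen x g; have [w ->] := gen g; elim: w => [|[b i] w IH] /=.
  rewrite a1; exact: rst_refl.
apply: rst_trans IH _; set y := a _ x; rewrite aM -/y; case: b.
  apply: rst_sym; apply: rst_step; right; exists i; split => //.
  by rewrite -aM gmulVr a1.
by apply: rst_step; right; exists i.
Qed.

(** The constant is the infimum of the volumes of spanning families over the Bernoulli action; each
    volume is at least the cost minus 1. *)
Lemma cost_isoperimetry (z : G) : finitely_generated G -> ~ torsion G ->
  (1%:E < group_cost G)%E ->
  exists (c : R) (K : {fset G}), [/\ 0 < c, gone G \in K &
    forall B : {fset G}, c * (#|` B|)%:R <= (#|` lines z (mulf K B)|)%:R].
Proof.
move=> fgG ntG cost1.
have [k [s gen]] := finitely_generated_gens fgG.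
have [code [decode [codeK decodeK]]] := countable_coding fgG ntG.
pose mu := @coin_measure R; pose a := @coin_action G code decode.
have a_pmp : pmp_action mu a by exact: (coin_action_pmp _ _ _ codeK decodeK).
have a_sep : finitely_separated mu a by exact: (coin_action_separated _ _ _ codeK).
have full := @spanning_full _ _ mu a z k s a_pmp gen.
pose vols : set R := [set v | exists E, [/\ forall i, measurable (E i),
  spanning a z s E & v = volume mu E]].
have cost_le v : vols v -> (group_cost G <= (1 + v)%:E)%E.
  move=> [E [mE cE ->]]; apply: le_trans (action_cost_le mu a a_pmp z s E mE cE).
  apply: ereal_inf_lbound; exists _, coin_space, mu, a; split; first exact: standard_borel_coin.
  by split => //; split => //; exact: (coin_action_free _ _ _ codeK).
have [v0 fullv] : exists v, vols v.
  by eexists; exists (fun=> setT); split; [move=> i; exact: measurableT|exact: full|].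
(* The full generator edges have finite volume, so the cost is finite. *)
have [r gr] : exists r, group_cost G = r%:E.
  have := cost_le _ fullv; move: cost1; case: (group_cost G) => [r _ _||].
  - by exists r.
  - by move=> _; rewrite leye_eq.
  - by rewrite ltNge leNye.
move: cost1; rewrite gr lte_fin => r1.
have lb : lbound vols (r - 1) by move=> v /cost_le; rewrite gr lee_fin; lra.
have c0 : 0 < inf vols.
  apply: (@lt_le_trans _ _ (r - 1)); first by rewrite subr_gt0.
  by apply: lb_le_inf => //; exists v0.
exists (inf vols), (gone G |` [fset s i | i in 'I_k])%fset; split => //.
  by rewrite !inE eqxx.
move=> B; apply: (@volume_le_lines G _ _ mu a a_pmp z k s _ _ _ a_sep).
- by move=> E mE cE; apply: ge_inf; [exists (r - 1)|exists E].
- move=> e e0; have [|v [E [mE cE ->]] vE] := @inf_adherent _ vols e e0.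
    by split; [exists v0|exists (r - 1)].
  by exists E.
- move=> b bB; split=> [|i]; apply: in_lines.
    by rewrite -[b]gmul1l; apply: in_mulf => //; rewrite !inE eqxx.
  apply: in_mulf => //; rewrite !inE; apply/orP; right.
  by apply/imfsetP; exists i.
Qed.
End CostIsoperimetry.

(** * From isoperimetry to expansion *)

Section Growth.
Import Order.TTheory GRing.Theory Num.Theory.
Local Close Scope ereal_scope.
Local Open Scope fset_scope.
Local Notation R := Rdefinitions.R.
Context {G : group} (z : G).
Hypothesis zinf : infinite_order z.
Implicit Types A B C : {fset G}.

Lemma mulfA A B C : mulf (mulf A B) C = mulf A (mulf B C).
Proof.
apply/fsetP => g; apply/imfset2P/imfset2P.
  move=> [_ /imfset2P[x xA [y yB ->]] [w wC ->]].
  by exists x => //; exists (gmul y w); [exact: in_mulf|rewrite gmulA].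
move=> [x xA [_ /imfset2P[y yB [w wC ->]] ->]].
by exists (gmul x y); [exact: in_mulf|exists w => //; rewrite gmulA].
Qed.

Lemma mul1f B : mulf [fset gone G] B = B.
Proof.
apply/fsetP => g; apply/imfset2P/idP.
  by move=> [x]; rewrite inE => /eqP -> [y yB ->]; rewrite gmul1l.
by move=> gB; exists (gone G); rewrite ?inE //; exists g => //; rewrite gmul1l.
Qed.

(** The forward half of a line is infinite, so it leaves the finite set [B]. *)
Lemma line_exit B g : g \in B ->
  exists h, [/\ h \in B, gmul z h \notin B & line z (gmul z h) = line z g].
Proof.
move=> gB; have [[n []]|none] := pselect (exists n, gmul (gpow z n) g \in B /\
    gmul (gpow z n.+1) g \notin B).
  move=> nB n1B; exists (gmul (gpow z n) g); split => //; first by rewrite gmulA.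
  by apply/lineP; exists n.+1; right; rewrite /= gmulA.
have allB n : gmul (gpow z n) g \in B.
  elim: n => [|n IH]; first by rewrite gmul1l.
  by apply/negPn/negP => h; apply: none; exists n.
have := @uniq_leq_size _ [seq gmul (gpow z n) g | n <- iota 0 (#|` B|).+1] B.
rewrite size_map size_iota ltnn => H; suff : false by []; apply: H.
  rewrite map_inj_uniq ?iota_uniq // => m n /gmulIr; exact: gpow_inj.
by move=> _ /mapP[n _ ->].
Qed.

Definition outward (K : {fset G}) : {fset G} := gone G |` mulf [fset z] K.

Fixpoint powf A n : {fset G} := if n is m.+1 then mulf A (powf A m) else [fset gone G].

(** Every line meeting [mulf K B] leaves it at a point outside [B], and different lines have
    different exits. *)
Lemma outward_card (K : {fset G}) B : gone G \in K ->
  (#|` B| + #|` lines z (mulf K B)| <= #|` mulf (outward K) B|)%N.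
Proof.
move=> K1; pose D := [fset g in mulf [fset z] (mulf K B) | g \notin B].
have BK g : g \in B -> g \in mulf K B by move=> gB; rewrite -[g]gmul1l; apply: in_mulf.
have lD : (#|` lines z (mulf K B)| <= #|` D|)%N.
  have sub : lines z (mulf K B) `<=` lines z D.
    apply/fsubsetP => l /imfsetP[g /= gKB ->].
    have [h [hKB zh <-]] := line_exit _ _ gKB; apply: in_lines.
    rewrite !inE; apply/andP; split; first by apply: in_mulf; rewrite ?inE.
    by apply: contra zh; exact: BK.
  by apply: leq_trans (fsubset_leq_card sub) _; exact: leq_imfset_card.
have disj : [disjoint B & D].
  by apply/fdisjointP => g gB; rewrite !inE gB /= andbF.
have sub : B `|` D `<=` mulf (outward K) B.
  apply/fsubsetP => g; rewrite in_fsetU => /orP[gB|].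
    by rewrite -[g]gmul1l; apply: in_mulf => //; rewrite !inE eqxx.
  rewrite !inE => /andP[]; rewrite -mulfA => /imfset2P[h hK [b bB ->]] _.
  by apply: in_mulf => //; rewrite inE hK orbT.
have := fsubset_leq_card sub; rewrite cardfsU (eqP disj).
by rewrite cardfs0 subn0; apply: leq_trans; rewrite leq_add2l.
Qed.

(** Each multiplication by [outward K] adds at least [c] times the size of [B]. This linear growth
    suffices: [n] with [n * c * c > 1] absorbs the factor [c] lost in a last use of the
    inequality. *)
Lemma lines_expansion (c : R) (K : {fset G}) : 0 < c -> gone G \in K ->
  (forall B, c * (#|` B|)%:R <= (#|` lines z (mulf K B)|)%:R) ->
  exists K', forall B, (#|` B| <= #|` lines z (mulf K' B)|)%N.
Proof.
move=> c0 K1 iso.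
have grow n B : (1 + n%:R * c) * (#|` B|)%:R <= (#|` mulf (powf (outward K) n) B|)%:R.
  elim: n => [|n IH]; first by rewrite mul0r addr0 mul1r mul1f.
  set B' := mulf (powf (outward K) n) B in IH.
  rewrite [powf _ _]/= mulfA -/B'.
  have := outward_card K B' K1; rewrite -(ler_nat R) natrD => h1; have h2 := iso B'.
  have h3 : (#|` B|)%:R <= (#|` B'|)%:R :> R.
    apply: le_trans IH; rewrite ler_peMl ?ler0n //.
    by rewrite lerDl mulr_ge0 ?ler0n // ltW.
  have h4 : c * (#|` B|)%:R <= c * (#|` B'|)%:R by rewrite ler_pM2l.
  rewrite -natr1; move: IH h1 h2 h4.
  set b := (#|` B|)%:R; set b' := (#|` B'|)%:R; set l := (#|` lines _ _|)%:R.
  set b'' := (#|` mulf _ _|)%:R; set m := n%:R; nra.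
have cc0 : 0 < c * c by rewrite mulr_gt0.
have : 0 <= (c * c)^-1 by rewrite invr_ge0 ltW.
move=> /archi_boundP; set n := Num.Def.archi_bound _ => nc.
exists (mulf K (powf (outward K) n)) => B; rewrite mulfA -(ler_nat R).
apply: le_trans (iso _); apply: (@le_trans _ _ (c * ((1 + n%:R * c) * (#|` B|)%:R))).
  rewrite mulrA ler_peMl ?ler0n //.
  have : 1 < n%:R * (c * c) by rewrite -ltr_pdivrMr // div1r.
  by rewrite mulrDr mulr1 mulrCA => /ltW h; rewrite (le_trans h) // lerDr ltW.
by rewrite ler_pM2l.
Qed.
End Growth.

(** * The half number of a non-torsion group of cost above 1 *)

Theorem theorem5p8 (G : group) :
  finitely_generated G -> ~ torsion G -> 1%:E < group_cost G ->
  tarski_half_number_is G 2.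
Proof.
move=> fgG ntG cost1; split; last by move=> k; exact: paradox_half_ge2.
have [z zinf] : exists z : G, infinite_order z.
  have /existsNP[z /forallNP zt] := ntG; exists z => n n0 zn.
  by apply: (zt n).
have [c [K [c0 K1 iso]]] := cost_isoperimetry z fgG ntG cost1.
have [K' expand] := lines_expansion z zinf c K c0 K1 iso.
have [code [decode [codeK decodeK]]] := countable_coding fgG ntG.
(* Hall's theorem assigns to each [x] its own line meeting the translate [K' x]; the expansion of
   lines is exactly Hall's condition. *)
have [||psi [psi_inj psiP]] := @hall_injection G (set G)
  (fun x => lines z (mulf K' [fset x]%fset)) decode.
- by move=> x; exists (code x).
- move=> B; apply: leq_trans (expand B) _; apply: fsubset_leq_card.
  apply/fsubsetP => l /imfsetP[_ /imfset2P[g gK [x xB ->]] ->].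
  apply/neighboursP; exists x => //; apply: in_lines.
  by apply: in_mulf => //; rewrite inE.
have q x : {g | g \in K' & psi x = line z (gmul g x)}.
  apply: cid2; have /imfsetP[h /imfset2P[g gK [y yx hE]] ->] := psiP x.
  by exists g => //; rewrite hE; move: yx; rewrite inE => /eqP ->.
(* The marked point of [x], on the line assigned to [x]; injectivity of [psi] leaves at most one on
   each line. *)
pose f x := gmul (s2val (q x)) x.
have psiE x : psi x = line z (f x) by exact: s2valP' (q x).
have fline x y : same_line z (f x) (f y) -> x = y.
  by move=> /lineP xy; apply: psi_inj; rewrite !psiE.
apply: (@paradox_half2 G z K' (fun x => s2val (q x)) f) => //.
  by move=> x y xy; apply: fline; rewrite xy; apply/lineP.
by move=> x; exact: s2valP (q x).
Qed.
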